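(* Let $\mathcal{S}=\{F_t\}_{t\ge 0}$ be a one-parameter continuous semigroup of $\rho$-nonexpansive self-mappings of the open unit ball $\mathbb{B}$ of a complex Hilbert space $\mathcal{H}$, generated by $f:\mathbb{B}\to\mathcal{H}$. Suppose that $f$ is uniformly continuous on each $\rho$-ball in $\mathbb{B}$, and that $\tau\in\partial\mathbb{B}$ is a null point of $f$ in the sense that $\lim_{r\to1^-}f(r\tau)=0$. Then the following assertions are equivalent: (I) $\displaystyle\limsup_{r\to1^-}\operatorname{Re}\frac{\langle f(r\tau),\tau\rangle}{r-1}>-\infty$; (II) $\displaystyle\alpha:=\lim_{r\to1^-}\operatorname{Re}\frac{\langle f(r\tau),\tau\rangle}{r-1}$ exists finitely; (III) $\displaystyle\beta:=\inf_{x\in\mathbb{B}}2\operatorname{Re}\langle f(x),x^*\rangle>-\infty$; (IV) there exists a real number $\gamma$ such that $$d_\tau(F_t(x))\le \exp(-t\gamma)\, d_\tau(x)\quad\text{for all }x\in\mathbb{B},\ t\ge0.$$ Moreover: (a) if these equivalent conditions hold, then $\alpha=\beta$, and the maximal $\gamma$ for which the inequality in (IV) holds is exactly the same $\beta$; (b) if $f$ is holomorphic and one (hence all) of conditions (I)--(IV) holds, then the limit $$\lim_{r\to1^-}\frac{\langle f(r\tau),\tau\rangle}{r-1}$$ exists and is actually a real number.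
   Context: $\mathcal{H}$ is a complex Hilbert space (not necessarily finite-dimensional) with inner product $\langle\cdot,\cdot\rangle$ (linear in the first argument) and norm $\|\cdot\|$; $\mathbb{B}=\{x\in\mathcal{H}:\|x\|<1\}$ and $\partial\mathbb{B}$ is its boundary, the unit sphere. The hyperbolic metric on $\mathbb{B}$ is $$\rho(x,y)=\tanh^{-1}\sqrt{1-\sigma(x,y)},\qquad \sigma(x,y)=\frac{(1-\|x\|^2)(1-\|y\|^2)}{|1-\langle x,y\rangle|^2},\quad x,y\in\mathbb{B}.$$ A $\rho$-ball is a ball in $\mathbb{B}$ with respect to the metric $\rho$. A self-mapping $F:\mathbb{B}\to\mathbb{B}$ is $\rho$-nonexpansive if $\rho(F(x),F(y))\le\rho(x,y)$ for all $x,y\in\mathbb{B}$. A family $\{F_t\}_{t\ge0}$ of self-mappings of $\mathbb{B}$ is a one-parameter continuous semigroup (flow) on $\mathbb{B}$ if $F_{t+s}=F_t\circ F_s$ for all $t,s\ge0$ and $\lim_{t\to0^+}F_t(x)=x$ in norm for each $x\in\mathbb{B}$. It is generated by $f:\mathbb{B}\to\mathcal{H}$ (and $f$ is its infinitesimal generator) if for each $x\in\mathbb{B}$ the strong (norm) limit $$f(x)=\lim_{t\to0^+}\frac1t\bigl(x-F_t(x)\bigr)$$ exists. For $\tau\in\partial\mathbb{B}$ and $x\in\mathbb{B}$, set $$d_\tau(x)=\frac{|1-\langle x,\tau\rangle|^2}{1-\|x\|^2},\qquad x^*=\frac{1}{1-\|x\|^2}\,x-\frac{1}{1-\langle\tau,x\rangle}\,\tau.$$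 *)

(* Defs.v *)
From Stdlib Require Import Reals.
From Coquelicot Require Import Coquelicot.
Open Scope R_scope.

(* The inner product is linear in its FIRST argument and induces the norm (hence the
   topology) of the underlying complete normed space; positivity and definiteness
   follow from [inner_norm] and the norm axioms. *)
Record HilbertSpace : Type := {
  hilbert_carrier :> CompleteNormedModule C_AbsRing;
  inner : hilbert_carrier -> hilbert_carrier -> C;
  inner_plus_l : forall x y z : hilbert_carrier,
    inner (plus x y) z = Cplus (inner x z) (inner y z);
  inner_scal_l : forall (a : C) (x y : hilbert_carrier),
    inner (scal a x) y = Cmult a (inner x y);
  inner_conj : forall x y : hilbert_carrier, inner y x = Cconj (inner x y);
  inner_norm : forall x : hilbert_carrier, inner x x = RtoC (norm x ^ 2)
}.
Arguments inner {_} _ _.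

(* Maps on the ball are total functions [H -> H]; only their values on the ball are
   ever constrained or used. *)
Definition unit_ball {H : HilbertSpace} (x : H) : Prop := norm x < 1.

Definition unit_sphere {H : HilbertSpace} (x : H) : Prop := norm x = 1.

(* The inverse hyperbolic tangent on (-1, 1), absent from the libraries. *)
Definition artanh (u : R) : R := / 2 * ln ((1 + u) / (1 - u)).

Definition sigma {H : HilbertSpace} (x y : H) : R :=
  (1 - norm x ^ 2) * (1 - norm y ^ 2) / Cmod (Cminus 1 (inner x y)) ^ 2.

Definition rho {H : HilbertSpace} (x y : H) : R := artanh (sqrt (1 - sigma x y)).

Definition rho_ball {H : HilbertSpace} (c : H) (r : R) (x : H) : Prop :=
  unit_ball x /\ rho c x < r.

Definition self_map {H : HilbertSpace} (G : H -> H) : Prop :=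
  forall x : H, unit_ball x -> unit_ball (G x).

Definition rho_nonexpansive {H : HilbertSpace} (G : H -> H) : Prop :=
  forall x y : H, unit_ball x -> unit_ball y -> rho (G x) (G y) <= rho x y.

Definition continuous_semigroup {H : HilbertSpace} (F : R -> H -> H) : Prop :=
  (forall t : R, 0 <= t -> self_map (F t)) /\
  (forall (t s : R) (x : H), 0 <= t -> 0 <= s -> unit_ball x ->
     F (t + s) x = F t (F s x)) /\
  (forall x : H, unit_ball x ->
     filterlim (fun t : R => F t x) (at_right 0) (locally x)).

Definition generated_by {H : HilbertSpace} (F : R -> H -> H) (f : H -> H) : Prop :=
  forall x : H, unit_ball x ->
    filterlim (fun t : R => scal (RtoC (/ t)) (minus x (F t x)))
      (at_right 0) (locally (f x)).

(* Uniform continuity with respect to the norm on both sides. *)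
Definition uniformly_continuous_on {H : HilbertSpace} (A : H -> Prop) (f : H -> H) : Prop :=
  forall eps : R, 0 < eps -> exists delta : R, 0 < delta /\
    forall x y : H, A x -> A y ->
      norm (minus x y) < delta -> norm (minus (f x) (f y)) < eps.

(* Complex Frechet differentiability at each point: the scalar field of H is C. *)
Definition holomorphic_on_ball {H : HilbertSpace} (f : H -> H) : Prop :=
  forall x : H, unit_ball x -> ex_filterdiff f (locally x).

Definition d_tau {H : HilbertSpace} (tau x : H) : R :=
  Cmod (Cminus 1 (inner x tau)) ^ 2 / (1 - norm x ^ 2).

Definition star {H : HilbertSpace} (tau x : H) : H :=
  minus (scal (RtoC (/ (1 - norm x ^ 2))) x)
        (scal (Cinv (Cminus 1 (inner tau x))) tau).

(* Upper limit along a filter: inf over the members P of F of sup_P g, in [Rbar]. *)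
Definition LimSup (F : (R -> Prop) -> Prop) (g : R -> R) : Rbar :=
  Rbar_glb (fun s : Rbar => exists P : R -> Prop,
    F P /\ s = Lub_Rbar (fun y : R => exists r : R, P r /\ y = g r)).

Definition radial_quotient {H : HilbertSpace} (f : H -> H) (tau : H) (r : R) : C :=
  Cdiv (inner (f (scal (RtoC r) tau)) tau) (RtoC (r - 1)).

Definition beta {H : HilbertSpace} (f : H -> H) (tau : H) : Rbar :=
  Glb_Rbar (fun y : R => exists x : H,
    unit_ball x /\ y = 2 * Re (inner (f x) (star tau x))).

Definition is_radial_limit {H : HilbertSpace} (f : H -> H) (tau : H) (alpha : R) : Prop :=
  filterlim (fun r : R => Re (radial_quotient f tau r)) (at_left 1) (locally alpha).

Definition decay_rate {H : HilbertSpace} (F : R -> H -> H) (tau : H) (gamma : R) : Prop :=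
  forall (x : H) (t : R), unit_ball x -> 0 <= t ->
    d_tau tau (F t x) <= exp (- t * gamma) * d_tau tau x.

Definition cond_I {H : HilbertSpace} (f : H -> H) (tau : H) : Prop :=
  Rbar_lt m_infty (LimSup (at_left 1) (fun r : R => Re (radial_quotient f tau r))).

Definition cond_II {H : HilbertSpace} (f : H -> H) (tau : H) : Prop :=
  exists alpha : R, is_radial_limit f tau alpha.

Definition cond_III {H : HilbertSpace} (f : H -> H) (tau : H) : Prop :=
  Rbar_lt m_infty (beta f tau).

Definition cond_IV {H : HilbertSpace} (F : R -> H -> H) (tau : H) : Prop :=
  exists gamma : R, decay_rate F tau gamma.

(* Main.v *)
From Stdlib Require Import Reals Lra Lia Classical ClassicalEpsilon.
From Coquelicot Require Import Coquelicot.
Require Import Defs.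
Open Scope R_scope.

(** The vector [x^*] is chosen so that [- 2 Re <f x, x^*>] is the logarithmic derivative of
    [d_tau (F t x)] at [t = 0].  Hence a decay rate [gamma] is a lower bound of the slopes
    [2 Re <f x, x^*>] ([slope_of_decay_rate]), and conversely a lower bound of the slopes integrates
    to a decay rate ([decay_rate_of_slope]); integration is by right derivatives
    ([nonpositive_right_derivative_le]), for which the orbits have to be continuous.  So
    [cond_III] and [cond_IV] are equivalent and the best rate is [beta].

    Differentiating [sigma (F t x) (F t y) >= sigma x y] at [t = 0] gives the monotonicity inequality
    [generator_rho_monotone].  With [y = r tau] and [r] tending to [1] it says that the quotient
    [Re <f (r tau), tau> / (r - 1)] is eventually below every slope, up to an arbitrarily small error
    ([radial_quotient_eventually_le]).  At the points [x = r tau] the slope is [2 / (1 + r)] times the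
    quotient.  Together, if the infimum [beta] of the slopes is finite then the quotient tends to
    [beta] ([radial_limit_beta]), and [beta] is finite as soon as the upper limit of the quotient is
    not [-oo].

    If [f] is holomorphic, put [g z = <f (z tau), tau>] on the unit disc.  The bound of the slopes by
    [beta] says that [p z = - 2 g z / (1 - z)^2 - beta (1 + z) / (1 - z)] has nonnegative real part,
    and the limit of the real part of the quotient says that [(1 - r) Re (p r)] tends to [0].
    The gradient bound [|Im p'| <= 2 Re p / R] at the centre of a disc of radius [R], integrated
    along the radius, yields that [(1 - r) Im (p r)] tends to [0] as well
    ([imaginary_part_negligible]); this is the imaginary part of the quotient.

    That gradient bound ([holomorphic_gradient_bound]) is Cauchy's theorem in polar coordinates for a
    kernel that is positive on the outer circle.  As [f] is only assumed to be differentiable at each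
    point, Cauchy's theorem is proved by Goursat's subdivision ([closed_form_circulation]). *)

(** * Closed forms on rectangles *)

Definition additive_on_rectangles (A B C D : R) (Phi : R -> R -> R -> R -> R) : Prop :=
  (forall a m b c d, A <= a -> a <= m -> m <= b -> b <= B -> C <= c -> c <= d -> d <= D ->
     Phi a b c d = Phi a m c d + Phi m b c d) /\
  (forall a b c m d, A <= a -> a <= b -> b <= B -> C <= c -> c <= m -> m <= d -> d <= D ->
     Phi a b c d = Phi a b c m + Phi a b m d).

Definition negligible_at (A B C D : R) (Phi : R -> R -> R -> R -> R) (x y : R) : Prop :=
  forall eps, 0 < eps -> exists delta, 0 < delta /\
    forall a b c d, A <= a -> a <= x -> x <= b -> b <= B ->
      C <= c -> c <= y -> y <= d -> d <= D -> b - a < delta -> d - c < delta ->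
      Rabs (Phi a b c d) <= eps * ((b - a) + (d - c)) ^ 2.

(** Quadrisection: if the value on the whole rectangle were nonzero, one of the four quarters
    would carry at least a quarter of it, and so on; the nested quarters shrink to a point
    where the function cannot be negligible compared with the area. *)
Lemma additive_negligible_zero (A B C D : R) (Phi : R -> R -> R -> R -> R) :
  A < B -> C < D -> additive_on_rectangles A B C D Phi ->
  (forall x y, A <= x <= B -> C <= y <= D -> negligible_at A B C D Phi x y) ->
  Phi A B C D = 0.
Proof.
  intros HAB HCD [Hx Hy] Hloc.
  destruct (Req_dec (Phi A B C D) 0) as [H0|H0]; [exact H0|exfalso].
  set (eta := Rabs (Phi A B C D)).
  assert (Heta : 0 < eta) by (apply Rabs_pos_lt; exact H0).
  set (L := B - A). set (M := D - C).
  assert (HL : 0 < L) by (unfold L; lra). assert (HM : 0 < M) by (unfold M; lra).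
  set (bad := fun (n : nat) (p : R * R) =>
    eta * (/ 4) ^ n <= Rabs (Phi (fst p) (fst p + L * (/ 2) ^ n) (snd p) (snd p + M * (/ 2) ^ n))).
  set (inn := fun (n : nat) (p : R * R) =>
    A <= fst p /\ fst p + L * (/ 2) ^ n <= B /\ C <= snd p /\ snd p + M * (/ 2) ^ n <= D).
  assert (Hpow : forall n, 0 < (/ 2) ^ n) by (intro n; apply pow_lt; lra).
  assert (Hstep : forall n p, inn n p -> bad n p -> exists q, inn (S n) q /\ bad (S n) q /\
      fst p <= fst q /\ fst q + L * (/ 2) ^ (S n) <= fst p + L * (/ 2) ^ n /\
      snd p <= snd q /\ snd q + M * (/ 2) ^ (S n) <= snd p + M * (/ 2) ^ n).
  { intros n [a c] (I1 & I2 & I3 & I4) Hb; unfold bad, inn in *; cbn [fst snd] in *.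
    specialize (Hpow n). assert (HLn := Rmult_lt_0_compat _ _ HL Hpow).
    assert (HMn := Rmult_lt_0_compat _ _ HM Hpow).
    change ((/ 2) ^ S n) with (/ 2 * (/ 2) ^ n). change ((/ 4) ^ S n) with (/ 4 * (/ 4) ^ n).
    set (l := L * (/ 2) ^ n) in *. set (m := M * (/ 2) ^ n) in *.
    replace (L * (/ 2 * (/ 2) ^ n)) with (l / 2) by (unfold l; field).
    replace (M * (/ 2 * (/ 2) ^ n)) with (m / 2) by (unfold m; field).
    set (e := eta * (/ 4 * (/ 4) ^ n)).
    replace (eta * (/ 4) ^ n) with (4 * e) in Hb by (unfold e; field).
    assert (E : Phi a (a + l) c (c + m) =
      (Phi a (a + l / 2) c (c + m / 2) + Phi a (a + l / 2) (c + m / 2) (c + m)) +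
      (Phi (a + l / 2) (a + l) c (c + m / 2) + Phi (a + l / 2) (a + l) (c + m / 2) (c + m))).
    { rewrite (Hx a (a + l / 2) (a + l) c (c + m)) by lra.
      rewrite (Hy a (a + l / 2) c (c + m / 2) (c + m)) by lra.
      rewrite (Hy (a + l / 2) (a + l) c (c + m / 2) (c + m)) by lra. ring. }
    assert (Hor : e <= Rabs (Phi a (a + l / 2) c (c + m / 2)) \/
                  e <= Rabs (Phi a (a + l / 2) (c + m / 2) (c + m)) \/
                  e <= Rabs (Phi (a + l / 2) (a + l) c (c + m / 2)) \/
                  e <= Rabs (Phi (a + l / 2) (a + l) (c + m / 2) (c + m))).
    { rewrite E in Hb. apply NNPP; intro Hn.
      apply not_or_and in Hn as [N1 Hn]. apply not_or_and in Hn as [N2 Hn].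
      apply not_or_and in Hn as [N3 N4]. apply Rnot_le_lt in N1, N2, N3, N4.
      revert Hb. apply Rlt_not_le.
      eapply Rle_lt_trans; [apply Rabs_triang|].
      eapply Rle_lt_trans; [apply Rplus_le_compat; apply Rabs_triang|]. lra. }
    destruct Hor as [Hq|[Hq|[Hq|Hq]]].
    - exists (a, c); cbn [fst snd]. repeat split; try lra. 
    - exists (a, c + m / 2); cbn [fst snd].
      replace (c + m / 2 + m / 2) with (c + m) by field. repeat split; try lra.
    - exists (a + l / 2, c); cbn [fst snd].
      replace (a + l / 2 + l / 2) with (a + l) by field. repeat split; try lra.
    - exists (a + l / 2, c + m / 2); cbn [fst snd].
      replace (a + l / 2 + l / 2) with (a + l) by field.
      replace (c + m / 2 + m / 2) with (c + m) by field. repeat split; try lra. }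
  assert (Hseq : exists s : nat -> R * R, forall n, inn n (s n) /\ bad n (s n) /\
      fst (s n) <= fst (s (S n)) /\
      fst (s (S n)) + L * (/ 2) ^ (S n) <= fst (s n) + L * (/ 2) ^ n /\
      snd (s n) <= snd (s (S n)) /\
      snd (s (S n)) + M * (/ 2) ^ (S n) <= snd (s n) + M * (/ 2) ^ n).
  { assert (Hch : forall np : nat * (R * R), exists q : R * R,
        inn (fst np) (snd np) -> bad (fst np) (snd np) ->
        inn (S (fst np)) q /\ bad (S (fst np)) q /\
        fst (snd np) <= fst q /\
        fst q + L * (/ 2) ^ (S (fst np)) <= fst (snd np) + L * (/ 2) ^ (fst np) /\
        snd (snd np) <= snd q /\
        snd q + M * (/ 2) ^ (S (fst np)) <= snd (snd np) + M * (/ 2) ^ (fst np)).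
    { intros [n p]; cbn [fst snd].
      destruct (classic (inn n p /\ bad n p)) as [[Hi Hb]|Hn].
      - destruct (Hstep n p Hi Hb) as [q Hq]. exists q. intros _ _. exact Hq.
      - exists p. intros Hi Hb. exfalso; apply Hn; split; assumption. }
    set (g := fun np => proj1_sig (constructive_indefinite_description _ (Hch np))).
    assert (Hg := fun np => proj2_sig (constructive_indefinite_description _ (Hch np))).
    cbv beta in Hg. fold g in Hg.
    set (s := fix s n := match n with O => (A, C) | S k => g (k, s k) end).
    exists s.
    assert (Hinv : forall n, inn n (s n) /\ bad n (s n)).
    { induction n as [|n [Hi Hb]].
      - unfold inn, bad, L, M; simpl. rewrite !Rmult_1_r.
        replace (A + (B - A)) with B by ring. replace (C + (D - C)) with D by ring.
        unfold eta. repeat split; lra.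
      - destruct (Hg (n, s n) Hi Hb) as (G1 & G2 & _). split; assumption. }
    intro n. destruct (Hinv n) as [Hi Hb]. split; [exact Hi|]. split; [exact Hb|].
    destruct (Hg (n, s n) Hi Hb) as (_ & _ & G). exact G. }
  destruct Hseq as [s Hs].
  assert (Hnest : forall (u : nat -> R) (l : R), 0 < l ->
      (forall n, u n <= u (S n) /\ u (S n) + l * (/ 2) ^ (S n) <= u n + l * (/ 2) ^ n) ->
      exists x, forall n, u n <= x <= u n + l * (/ 2) ^ n).
  { intros u l Hl Hu.
    assert (Hmono : forall n k, u n <= u (n + k)%nat /\
        u (n + k)%nat + l * (/ 2) ^ (n + k) <= u n + l * (/ 2) ^ n).
    { intros n k; induction k as [|k [IH1 IH2]].
      - rewrite Nat.add_0_r; lra.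
      - rewrite Nat.add_succ_r. destruct (Hu (n + k)%nat). lra. }
    assert (Hle : forall n m, u m <= u n + l * (/ 2) ^ n).
    { intros n m. destruct (Nat.le_ge_cases n m) as [Hnm|Hnm].
      - destruct (Hmono n (m - n)%nat) as [_ H2].
        replace (n + (m - n))%nat with m in H2 by lia.
        assert (0 < l * (/ 2) ^ m) by (apply Rmult_lt_0_compat; auto). lra.
      - destruct (Hmono m (n - m)%nat) as [H1 _].
        replace (m + (n - m))%nat with n in H1 by lia.
        assert (0 < l * (/ 2) ^ n) by (apply Rmult_lt_0_compat; auto). lra. }
    destruct (completeness (fun r => exists n, r = u n)) as [x [Hub Hlub]].
    - exists (u O + l * (/ 2) ^ 0). intros r [n ->]. apply Hle.
    - exists (u O), O; reflexivity.
    - exists x. intro n. split; [apply Hub; exists n; reflexivity|].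
      apply Hlub. intros r [m ->]. apply Hle. }
  destruct (Hnest (fun n => fst (s n)) L HL) as [x Hxn].
  { intro n; destruct (Hs n) as (_ & _ & G1 & G2 & _); split; assumption. }
  destruct (Hnest (fun n => snd (s n)) M HM) as [y Hyn].
  { intro n; destruct (Hs n) as (_ & _ & _ & _ & G1 & G2); split; assumption. }
  assert (Hxy : A <= x <= B /\ C <= y <= D).
  { specialize (Hxn O); specialize (Hyn O); destruct (Hs O) as [(I1 & I2 & I3 & I4) _].
    simpl in *. lra. }
  destruct Hxy as [Hx0 Hy0].
  assert (He : 0 < eta / (2 * (L + M) ^ 2)).
  { apply Rdiv_lt_0_compat; [exact Heta|]. apply Rmult_lt_0_compat; [lra|apply pow_lt; lra]. }
  destruct (Hloc x y Hx0 Hy0 _ He) as (delta & Hd & Hsmall).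
  destruct (pow_lt_1_zero (/ 2)) with (y := delta / (L + M)) as [N HN].
  { rewrite Rabs_pos_eq; lra. }
  { apply Rdiv_lt_0_compat; lra. }
  specialize (HN N (Nat.le_refl N)). rewrite Rabs_pos_eq in HN by (left; apply Hpow).
  assert (Hlt : (L + M) * (/ 2) ^ N < delta).
  { apply Rmult_lt_compat_l with (r := L + M) in HN; [|lra].
    replace ((L + M) * (delta / (L + M))) with delta in HN by (field; lra). exact HN. }
  rewrite Rmult_plus_distr_r in Hlt.
  assert (HLN := Rmult_lt_0_compat _ _ HL (Hpow N)).
  assert (HMN := Rmult_lt_0_compat _ _ HM (Hpow N)).
  destruct (Hs N) as [(I1 & I2 & I3 & I4) [Hb _]]. unfold bad in Hb.
  specialize (Hxn N). specialize (Hyn N). cbv beta in Hxn, Hyn.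
  specialize (Hsmall (fst (s N)) (fst (s N) + L * (/ 2) ^ N)
                     (snd (s N)) (snd (s N) + M * (/ 2) ^ N)).
  assert (Hfin := Rle_trans _ _ _ Hb (Hsmall I1 (proj1 Hxn) (proj2 Hxn) I2 I3 (proj1 Hyn)
      (proj2 Hyn) I4 ltac:(lra) ltac:(lra))).
  replace (eta / (2 * (L + M) ^ 2) * (fst (s N) + L * (/ 2) ^ N - fst (s N) +
     (snd (s N) + M * (/ 2) ^ N - snd (s N))) ^ 2) with (eta / 2 * ((/ 2) ^ N * (/ 2) ^ N)) in Hfin
    by (field; lra).
  rewrite <- Rpow_mult_distr in Hfin. replace (/ 2 * / 2) with (/ 4) in Hfin by field.
  assert (0 < (/ 4) ^ N) by (apply pow_lt; lra).
  assert (0 < eta * (/ 4) ^ N) by (apply Rmult_lt_0_compat; assumption). lra.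
Qed.
Lemma differentiable_continuous_1 (P : R -> R -> R) (x y px py : R) :
  differentiable_pt_lim P x y px py -> continuous (fun u => P u y) x.
Proof.
  intro HP. apply continuity_pt_filterlim, derivable_continuous_pt. exists px.
  replace px with (px * 1 + py * 0) by ring.
  apply (derivable_pt_lim_comp_2d P (fun u => u) (fun _ => y)); [exact HP| |].
  - apply derivable_pt_lim_id.
  - apply derivable_pt_lim_const.
Qed.

Lemma differentiable_continuous_2 (P : R -> R -> R) (x y px py : R) :
  differentiable_pt_lim P x y px py -> continuous (fun v => P x v) y.
Proof.
  intro HP. apply continuity_pt_filterlim, derivable_continuous_pt. exists py.
  replace py with (px * 0 + py * 1) by ring.
  apply (derivable_pt_lim_comp_2d P (fun _ => x) (fun v => v)); [exact HP| |].
  - apply derivable_pt_lim_const.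
  - apply derivable_pt_lim_id.
Qed.

Lemma RInt_near_const (g : R -> R) (a b k e : R) :
  a <= b -> ex_RInt g a b -> (forall x, a <= x <= b -> Rabs (g x - k) <= e) ->
  Rabs (RInt g a b - k * (b - a)) <= e * (b - a).
Proof.
  intros Hab Hg Hk.
  assert (Hc : forall q, RInt (fun _ => q) a b = q * (b - a))
    by (intro q; rewrite RInt_const; apply Rmult_comm).
  apply Rabs_le_between'. split.
  - replace (k * (b - a) - e * (b - a)) with ((k - e) * (b - a)) by ring. rewrite <- Hc.
    apply RInt_le; [exact Hab|apply ex_RInt_const|exact Hg|].
    intros x Hx. specialize (Hk x ltac:(lra)). apply Rabs_le_between' in Hk. lra.
  - replace (k * (b - a) + e * (b - a)) with ((k + e) * (b - a)) by ring. rewrite <- Hc.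
    apply RInt_le; [exact Hab|exact Hg|apply ex_RInt_const|].
    intros x Hx. specialize (Hk x ltac:(lra)). apply Rabs_le_between' in Hk. lra.
Qed.

(** Goursat's form of Green's theorem: the partial derivatives need not be continuous.  Near a
    point of a small rectangle the form is a closed form with affine coefficients, up to an
    error negligible compared with the area, and [additive_negligible_zero] applies. *)
Lemma closed_form_circulation (P Q : R -> R -> R) (A B C D : R) :
  A < B -> C < D ->
  (forall x y, A <= x <= B -> C <= y <= D -> exists px k qy,
     differentiable_pt_lim P x y px k /\ differentiable_pt_lim Q x y k qy) ->
  RInt (fun x => P x C - P x D) A B + RInt (fun y => Q B y - Q A y) C D = 0.
Proof.
  intros HAB HCD Hdiff.
  assert (HexP : forall a b c d, A <= a -> a <= b -> b <= B -> C <= c <= D -> C <= d <= D ->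
      ex_RInt (fun x => P x c - P x d) a b).
  { intros a b c d Ha Hab Hb Hc Hd. apply (ex_RInt_continuous (V := R_CompleteNormedModule)).
    intros x Hx. rewrite Rmin_left, Rmax_right in Hx by exact Hab.
    destruct (Hdiff x c ltac:(lra) Hc) as (p1 & k1 & q1 & H1 & _).
    destruct (Hdiff x d ltac:(lra) Hd) as (p2 & k2 & q2 & H2 & _).
    apply (continuous_minus (V := R_NormedModule));
      eapply differentiable_continuous_1; eassumption. }
  assert (HexQ : forall a b c d, C <= c -> c <= d -> d <= D -> A <= a <= B -> A <= b <= B ->
      ex_RInt (fun y => Q b y - Q a y) c d).
  { intros a b c d Hc Hcd Hd Ha Hb. apply (ex_RInt_continuous (V := R_CompleteNormedModule)).
    intros y Hy. rewrite Rmin_left, Rmax_right in Hy by exact Hcd.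
    destruct (Hdiff a y Ha ltac:(lra)) as (p1 & k1 & q1 & _ & H1).
    destruct (Hdiff b y Hb ltac:(lra)) as (p2 & k2 & q2 & _ & H2).
    apply (continuous_minus (V := R_NormedModule));
      eapply differentiable_continuous_2; eassumption. }
  set (Phi := fun a b c d =>
    RInt (fun x => P x c - P x d) a b + RInt (fun y => Q b y - Q a y) c d).
  change (Phi A B C D = 0).
  apply additive_negligible_zero; [exact HAB|exact HCD| |].
  - split.
    + intros a m b c d H1 H2 H3 H4 H5 H6 H7. unfold Phi.
      rewrite <- (RInt_Chasles (fun x => P x c - P x d) a m b) by (apply HexP; lra).
      rewrite (RInt_ext (fun y => Q b y - Q a y)
        (fun y => plus (Q m y - Q a y) (Q b y - Q m y))).
      2:{ intros y _. unfold plus; simpl. ring. }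
      rewrite (RInt_plus (V := R_CompleteNormedModule)) by (apply HexQ; lra).
      unfold plus; simpl. ring.
    + intros a b c m d H1 H2 H3 H4 H5 H6 H7. unfold Phi.
      rewrite <- (RInt_Chasles (fun y => Q b y - Q a y) c m d) by (apply HexQ; lra).
      rewrite (RInt_ext (fun x => P x c - P x d)
        (fun x => plus (P x c - P x m) (P x m - P x d))).
      2:{ intros y _. unfold plus; simpl. ring. }
      rewrite (RInt_plus (V := R_CompleteNormedModule)) by (apply HexP; lra).
      unfold plus; simpl. ring.
  - intros x y Hx Hy eps Heps.
    destruct (Hdiff x y Hx Hy) as (px & k & qy & HP & HQ).
    destruct (HP (mkposreal _ (is_pos_div_2 (mkposreal eps Heps)))) as [d1 Hd1].
    destruct (HQ (mkposreal _ (is_pos_div_2 (mkposreal eps Heps)))) as [d2 Hd2].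
    simpl in Hd1, Hd2.
    exists (Rmin d1 d2). split; [apply Rmin_pos; apply cond_pos|].
    intros a b c d Ha Hax Hxb Hb Hc Hcy Hyd Hd Hw Hh.
    assert (Rmin d1 d2 <= d1) by apply Rmin_l. assert (Rmin d1 d2 <= d2) by apply Rmin_r.
    set (s := (b - a) + (d - c)).
    assert (Hbox : forall u v, a <= u <= b -> c <= v <= d ->
        Rabs (u - x) < Rmin d1 d2 /\ Rabs (v - y) < Rmin d1 d2 /\
        Rmax (Rabs (u - x)) (Rabs (v - y)) <= s).
    { intros u v Hu Hv.
      assert (Rabs (u - x) <= b - a) by (apply Rabs_le; lra).
      assert (Rabs (v - y) <= d - c) by (apply Rabs_le; lra).
      split; [lra|]. split; [lra|]. unfold s. apply Rmax_lub; lra. }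
    assert (EP : forall u v, a <= u <= b -> c <= v <= d ->
        Rabs (P u v - P x y - (px * (u - x) + k * (v - y))) <= eps / 2 * s).
    { intros u v Hu Hv. destruct (Hbox u v Hu Hv) as (B1 & B2 & B3).
      eapply Rle_trans; [apply Hd1; lra|]. apply Rmult_le_compat_l; lra. }
    assert (EQ : forall u v, a <= u <= b -> c <= v <= d ->
        Rabs (Q u v - Q x y - (k * (u - x) + qy * (v - y))) <= eps / 2 * s).
    { intros u v Hu Hv. destruct (Hbox u v Hu Hv) as (B1 & B2 & B3).
      eapply Rle_trans; [apply Hd2; lra|]. apply Rmult_le_compat_l; lra. }
    assert (IP : Rabs (RInt (fun x => P x c - P x d) a b - k * (c - d) * (b - a))
                 <= eps * s * (b - a)).
    { apply RInt_near_const; [lra|apply HexP; lra|]. intros u Hu.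
      assert (E1 := EP u c Hu ltac:(lra)). assert (E2 := EP u d Hu ltac:(lra)).
      apply Rabs_le_between in E1. apply Rabs_le_between in E2. apply Rabs_le. lra. }
    assert (IQ : Rabs (RInt (fun y => Q b y - Q a y) c d - k * (b - a) * (d - c))
                 <= eps * s * (d - c)).
    { apply RInt_near_const; [lra|apply HexQ; lra|]. intros v Hv.
      assert (E1 := EQ a v ltac:(lra) Hv). assert (E2 := EQ b v ltac:(lra) Hv).
      apply Rabs_le_between in E1. apply Rabs_le_between in E2. apply Rabs_le. lra. }
    unfold Phi. fold s.
    apply Rabs_le_between in IP. apply Rabs_le_between in IQ. apply Rabs_le.
    replace (eps * s ^ 2) with (eps * s * (b - a) + eps * s * (d - c)) by (unfold s; ring).
    lra.
Qed.
(** * A gradient bound for holomorphic functions with positive real part *)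

Lemma differentiable_pt_lim_eq (f : R -> R -> R) (x y a b a' b' : R) :
  differentiable_pt_lim f x y a b -> a = a' -> b = b' -> differentiable_pt_lim f x y a' b'.
Proof. intros Hf <- <-. exact Hf. Qed.

Lemma differentiable_pt_lim_Rmult (x y : R) : differentiable_pt_lim Rmult x y y x.
Proof.
  intro eps. exists eps. intros u v Hu Hv.
  replace (u * v - x * y - (y * (u - x) + x * (v - y))) with ((u - x) * (v - y)) by ring.
  rewrite Rabs_mult. apply Rmult_le_compat; try apply Rabs_pos; [lra|apply Rmax_r].
Qed.

Lemma differentiable_pt_lim_Rplus (x y : R) : differentiable_pt_lim Rplus x y 1 1.
Proof.
  intro eps. exists eps. intros u v _ _.
  replace (u + v - (x + y) - (1 * (u - x) + 1 * (v - y))) with 0 by ring. rewrite Rabs_R0.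
  apply Rmult_le_pos; [left; apply cond_pos|].
  eapply Rle_trans; [apply Rabs_pos|apply Rmax_l].
Qed.

Lemma differentiable_pt_lim_separated (k g h : R -> R) (r t k' g' h' : R) :
  derivable_pt_lim k r k' -> derivable_pt_lim g r g' -> derivable_pt_lim h t h' ->
  differentiable_pt_lim (fun r t => k r + g r * h t) r t (k' + g' * h t) (g r * h').
Proof.
  intros Hk Hg Hh.
  assert (Hh2 : differentiable_pt_lim (fun _ v => h v) r t 0 h').
  { apply differentiable_pt_lim_eq with (1 := differentiable_pt_lim_comp
      (fun a _ => h a) (fun _ v => v) (fun u _ => u) r t h' 0 0 1 1 0
      (differentiable_pt_lim_proj1_0 h t r h' Hh)
      ltac:(intro eps; exists eps; intros u v _ _;
        replace (v - t - (0 * (u - r) + 1 * (v - t))) with 0 by ring; rewrite Rabs_R0;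
        apply Rmult_le_pos; [left; apply cond_pos|];
        eapply Rle_trans; [apply Rabs_pos|apply Rmax_l])
      (differentiable_pt_lim_proj1_0 (fun u => u) r t 1 (derivable_pt_lim_id r))); ring. }
  apply differentiable_pt_lim_proj1_0 with (y := t) in Hk.
  apply differentiable_pt_lim_proj1_0 with (y := t) in Hg.
  eapply differentiable_pt_lim_eq.
  - apply (differentiable_pt_lim_comp Rplus (fun r _ => k r) (fun r t => g r * h t)).
    + apply differentiable_pt_lim_Rplus.
    + exact Hk.
    + apply (differentiable_pt_lim_comp Rmult (fun r _ => g r) (fun _ t => h t));
        [apply differentiable_pt_lim_Rmult|exact Hg|exact Hh2].
  - ring.
  - ring.
Qed.

Lemma differentiable_pt_lim_combination (U V E G : R -> R -> R)
    (r t Ur Ut Vr Vt Er Et Gr Gt : R) :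
  differentiable_pt_lim U r t Ur Ut -> differentiable_pt_lim V r t Vr Vt ->
  differentiable_pt_lim E r t Er Et -> differentiable_pt_lim G r t Gr Gt ->
  differentiable_pt_lim (fun r t => U r t * E r t + V r t * G r t) r t
    (Ur * E r t + U r t * Er + (Vr * G r t + V r t * Gr))
    (Ut * E r t + U r t * Et + (Vt * G r t + V r t * Gt)).
Proof.
  intros HU HV HE HG. eapply differentiable_pt_lim_eq.
  - apply (differentiable_pt_lim_comp Rplus (fun r t => U r t * E r t) (fun r t => V r t * G r t)).
    + apply differentiable_pt_lim_Rplus.
    + apply (differentiable_pt_lim_comp Rmult U E);
        [apply differentiable_pt_lim_Rmult|exact HU|exact HE].
    + apply (differentiable_pt_lim_comp Rmult V G);
        [apply differentiable_pt_lim_Rmult|exact HV|exact HG].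
  - ring.
  - ring.
Qed.

(** [a + b i] is the complex derivative of [u + i v] at [x + i y]. *)
Definition cauchy_riemann (u v : R -> R -> R) (x y a b : R) : Prop :=
  differentiable_pt_lim u x y a (- b) /\ differentiable_pt_lim v x y b a.

Lemma differentiable_polar (u : R -> R -> R) (x0 y0 r t ux uy : R) :
  differentiable_pt_lim u (x0 + r * cos t) (y0 + r * sin t) ux uy ->
  differentiable_pt_lim (fun r t => u (x0 + r * cos t) (y0 + r * sin t)) r t
    (ux * cos t + uy * sin t) (r * (uy * cos t - ux * sin t)).
Proof.
  intro Hu. eapply differentiable_pt_lim_eq.
  - apply (differentiable_pt_lim_comp u (fun r t => x0 + r * cos t) (fun r t => y0 + r * sin t)).
    + exact Hu.
    + apply (differentiable_pt_lim_separated (fun _ => x0) (fun r => r) cos);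
        [apply derivable_pt_lim_const|apply derivable_pt_lim_id|apply derivable_pt_lim_cos].
    + apply (differentiable_pt_lim_separated (fun _ => y0) (fun r => r) sin);
        [apply derivable_pt_lim_const|apply derivable_pt_lim_id|apply derivable_pt_lim_sin].
  - simpl. ring.
  - simpl. ring.
Qed.

(** For [p = u + i v] and [z = r exp(i t)] measured from the centre, the form is the imaginary
    part of [p K(z) dz] with the kernel [K(z) = 2 / (R z) + i s (1 / z^2 - 1 / R^2)], holomorphic on
    the punctured disc.  On the circle [r = R] the coefficient of [v dt] vanishes. *)
Lemma polar_kernel_closed (u v : R -> R -> R) (x0 y0 R s r t a b : R) :
  0 < r -> 0 < R ->
  cauchy_riemann u v (x0 + r * cos t) (y0 + r * sin t) a b ->
  let U := fun r t => u (x0 + r * cos t) (y0 + r * sin t) in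
  let V := fun r t => v (x0 + r * cos t) (y0 + r * sin t) in
  exists pr k qt,
    differentiable_pt_lim (fun r t => U r t * (0 + s * (/ r ^ 2 - / R ^ 2) * cos t) +
      V r t * (2 / R * / r + s * (/ r ^ 2 + / R ^ 2) * sin t)) r t pr k /\
    differentiable_pt_lim (fun r t => U r t * (2 / R + s * (/ r + r / R ^ 2) * sin t) +
      V r t * (0 + s * (r / R ^ 2 - / r) * cos t)) r t k qt.
Proof.
  intros Hr HR [Hu Hv] U V.
  apply differentiable_polar in Hu. apply differentiable_polar in Hv.
  assert (D1 : derivable_pt_lim (fun r => s * (/ r ^ 2 - / R ^ 2)) r (- 2 * s / r ^ 3)).
  { apply is_derive_Reals. auto_derive; [simpl; nra|]. field. lra. }
  assert (D2 : derivable_pt_lim (fun r => s * (/ r ^ 2 + / R ^ 2)) r (- 2 * s / r ^ 3)).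
  { apply is_derive_Reals. auto_derive; [simpl; nra|]. field. lra. }
  assert (D3 : derivable_pt_lim (fun r => 2 / R * / r) r (- (2 / R) / r ^ 2)).
  { apply is_derive_Reals. auto_derive; [lra|]. field. lra. }
  assert (D4 : derivable_pt_lim (fun r => s * (/ r + r / R ^ 2)) r (s * (/ R ^ 2 - / r ^ 2))).
  { apply is_derive_Reals. auto_derive; [lra|]. field. lra. }
  assert (D5 : derivable_pt_lim (fun r => s * (r / R ^ 2 - / r)) r (s * (/ R ^ 2 + / r ^ 2))).
  { apply is_derive_Reals. auto_derive; [lra|]. field. lra. }
  do 3 eexists. split.
  - eapply differentiable_pt_lim_combination; [exact Hu|exact Hv| |].
    + apply (differentiable_pt_lim_separated (fun _ => 0) (fun r => s * (/ r ^ 2 - / R ^ 2)) cos);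
        [apply derivable_pt_lim_const|exact D1|apply derivable_pt_lim_cos].
    + apply (differentiable_pt_lim_separated (fun r => 2 / R * / r)
        (fun r => s * (/ r ^ 2 + / R ^ 2)) sin); [exact D3|exact D2|apply derivable_pt_lim_sin].
  - eapply differentiable_pt_lim_eq.
    + eapply differentiable_pt_lim_combination; [exact Hu|exact Hv| |].
      * apply (differentiable_pt_lim_separated (fun _ => 2 / R) (fun r => s * (/ r + r / R ^ 2)) sin);
          [apply derivable_pt_lim_const|exact D4|apply derivable_pt_lim_sin].
      * apply (differentiable_pt_lim_separated (fun _ => 0) (fun r => s * (r / R ^ 2 - / r)) cos);
          [apply derivable_pt_lim_const|exact D5|apply derivable_pt_lim_cos].
    + cbv beta. field. lra.
    + reflexivity.
Qed.
(** The integral over a circle of the closed form of [polar_kernel_closed] does not depend on the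
    radius.  On the circle of radius [R] its density is [2 / R * u * (1 + s * sin t)], which is
    nonnegative; as the radius tends to [0] the integral tends to
    [2 * PI * (2 / R * u - s * b)], taken at the centre. *)
Lemma holomorphic_gradient_bound (u v : R -> R -> R) (x0 y0 R a0 b0 : R) :
  0 < R ->
  (forall r t, 0 < r <= R -> exists a b,
     cauchy_riemann u v (x0 + r * cos t) (y0 + r * sin t) a b) ->
  (forall t, 0 <= u (x0 + R * cos t) (y0 + R * sin t)) ->
  cauchy_riemann u v x0 y0 a0 b0 ->
  Rabs b0 <= 2 / R * u x0 y0.
Proof.
  intros HR Hcr Hpos H0.
  assert (Hs : forall s, Rabs s <= 1 -> s * b0 <= 2 / R * u x0 y0).
  2:{ apply Rabs_le. split.
      - specialize (Hs (Ropp 1)). rewrite Rabs_Ropp, Rabs_R1 in Hs. lra.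
      - specialize (Hs 1). rewrite Rabs_R1 in Hs. lra. }
  intros s Hs. apply le_epsilon. intros eta Heta.
  set (u0 := u x0 y0). set (v0 := v x0 y0).
  set (U := fun r t => u (x0 + r * cos t) (y0 + r * sin t)).
  set (V := fun r t => v (x0 + r * cos t) (y0 + r * sin t)).
  set (P := fun r t => U r t * (0 + s * (/ r ^ 2 - / R ^ 2) * cos t) +
      V r t * (2 / R * / r + s * (/ r ^ 2 + / R ^ 2) * sin t)).
  set (Q := fun r t => U r t * (2 / R + s * (/ r + r / R ^ 2) * sin t) +
      V r t * (0 + s * (r / R ^ 2 - / r) * cos t)).
  destruct H0 as [Hu Hv].
  set (e := Rmin 1 (eta / 4)).
  assert (He : 0 < e) by (apply Rmin_pos; lra).
  assert (He1 : e <= 1) by apply Rmin_l. assert (He4 : e <= eta / 4) by apply Rmin_r.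
  destruct (Hu (mkposreal e He)) as [d1 Hd1]. destruct (Hv (mkposreal e He)) as [d2 Hd2].
  simpl in Hd1, Hd2.
  (* [r * K] bounds [U - u0] and [V - v0], and [r * M] the part of the error that has a factor
     [r]; the Taylor remainders contribute the other part, [2 * e]. *)
  set (K := Rabs a0 + Rabs b0 + 1).
  set (M := 2 / R * K + (Rabs u0 + Rabs v0 + 2 * K) / R ^ 2).
  assert (HK : 0 < K) by (unfold K; assert (P1 := Rabs_pos a0); assert (P2 := Rabs_pos b0); lra).
  assert (HR2 : 0 < / R ^ 2) by (apply Rinv_0_lt_compat, pow_lt, HR).
  assert (HR1 : 0 < 2 / R) by (apply Rdiv_lt_0_compat; lra).
  assert (HM : 0 < M).
  { unfold M. apply Rplus_lt_0_compat; [apply Rmult_lt_0_compat; assumption|].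
    apply Rmult_lt_0_compat; [|exact HR2].
    assert (P1 := Rabs_pos u0); assert (P2 := Rabs_pos v0); lra. }
  assert (Hr : exists r, 0 < r /\ r < R /\ r < 1 /\ r < d1 /\ r < d2 /\ r * M <= eta / 2).
  { assert (E1 := cond_pos d1). assert (E2 := cond_pos d2).
    assert (E3 : 0 < eta / 2 / M) by (apply Rdiv_lt_0_compat; lra).
    set (r := Rmin (Rmin R 1) (Rmin (Rmin d1 d2) (eta / 2 / M))).
    assert (E0 : 0 < r) by (unfold r; repeat apply Rmin_pos; lra).
    assert (r <= Rmin R 1) by apply Rmin_l.
    assert (r <= Rmin (Rmin d1 d2) (eta / 2 / M)) by apply Rmin_r.
    assert (Rmin R 1 <= R) by apply Rmin_l. assert (Rmin R 1 <= 1) by apply Rmin_r.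
    assert (Rmin (Rmin d1 d2) (eta / 2 / M) <= Rmin d1 d2) by apply Rmin_l.
    assert (F : Rmin (Rmin d1 d2) (eta / 2 / M) <= eta / 2 / M) by apply Rmin_r.
    assert (Rmin d1 d2 <= d1) by apply Rmin_l. assert (Rmin d1 d2 <= d2) by apply Rmin_r.
    exists (r / 2). repeat split; try lra.
    assert (G : r <= eta / 2 / M) by lra. apply Rmult_le_compat_r with (r := M) in G; [|lra].
    replace (eta / 2 / M * M) with (eta / 2) in G by (field; lra).
    assert (0 < r * M) by (apply Rmult_lt_0_compat; assumption). lra. }
  destruct Hr as (r & Hr0 & HrR & Hr1 & Hrd1 & Hrd2 & HrM).
  assert (Hcirc : RInt (fun t => Q R t - Q r t) 0 (2 * PI) = 0).
  { assert (HPI := PI_RGT_0).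
    assert (Hz : RInt (fun x => P x 0 - P x (2 * PI)) r R = 0).
    { rewrite (RInt_ext _ (fun _ => 0)).
      - rewrite RInt_const. apply Rmult_0_r.
      - intros x _. change (P x 0 - P x (2 * PI) = 0). unfold P, U, V.
        rewrite cos_2PI, sin_2PI, cos_0, sin_0. ring. }
    assert (Hc := closed_form_circulation P Q r R 0 (2 * PI) HrR ltac:(lra)).
    rewrite Hz, Rplus_0_l in Hc. apply Hc.
    intros x t Hx Ht. destruct (Hcr x t ltac:(lra)) as (a & b & Hab).
    apply (polar_kernel_closed u v x0 y0 R s x t a b); [lra|exact HR|exact Hab]. }
  assert (Hmax : forall t, Rmax (Rabs (x0 + r * cos t - x0)) (Rabs (y0 + r * sin t - y0)) <= r).
  { intro t. replace (x0 + r * cos t - x0) with (r * cos t) by ring.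
    replace (y0 + r * sin t - y0) with (r * sin t) by ring.
    rewrite !Rabs_mult, (Rabs_pos_eq r) by lra.
    assert (Rabs (cos t) <= 1) by (apply Rabs_le; apply COS_bound).
    assert (Rabs (sin t) <= 1) by (apply Rabs_le; apply SIN_bound).
    apply Rmax_lub; nra. }
  set (G := fun t => 2 / R * u0 - s * b0 + eta + s / r * (u0 * sin t - v0 * cos t)).
  assert (HQr : forall t, Q r t <= G t).
  { intro t. specialize (Hmax t).
    assert (N1 := Rmax_l (Rabs (x0 + r * cos t - x0)) (Rabs (y0 + r * sin t - y0))).
    assert (N2 := Rmax_r (Rabs (x0 + r * cos t - x0)) (Rabs (y0 + r * sin t - y0))).
    assert (E1 := Hd1 (x0 + r * cos t) (y0 + r * sin t) ltac:(lra) ltac:(lra)).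
    assert (E2 := Hd2 (x0 + r * cos t) (y0 + r * sin t) ltac:(lra) ltac:(lra)).
    assert (Emax : e * Rmax (Rabs (x0 + r * cos t - x0)) (Rabs (y0 + r * sin t - y0)) <= e * r)
      by (apply Rmult_le_compat_l; lra).
    apply Rle_trans with (2 := Emax) in E1. apply Rle_trans with (2 := Emax) in E2.
    clear Emax N1 N2 Hmax.
    fold (U r t) u0 in E1. fold (V r t) v0 in E2.
    set (c := cos t) in *. set (z := sin t) in *.
    assert (Hc1 : Rabs c <= 1) by (apply Rabs_le; apply COS_bound).
    assert (Hz1 : Rabs z <= 1) by (apply Rabs_le; apply SIN_bound).
    assert (Hcz : c * c + z * z = 1) by (unfold c, z; rewrite Rplus_comm; apply sin2_cos2).
    set (e1 := U r t - u0 - (a0 * (x0 + r * c - x0) + - b0 * (y0 + r * z - y0))) in E1.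
    set (e2 := V r t - v0 - (b0 * (x0 + r * c - x0) + a0 * (y0 + r * z - y0))) in E2.
    assert (EU : U r t = u0 + r * (a0 * c - b0 * z) + e1) by (unfold e1; ring).
    assert (EV : V r t = v0 + r * (b0 * c + a0 * z) + e2) by (unfold e2; ring).
    assert (prod_le : forall p q k, Rabs p <= k -> Rabs q <= 1 -> Rabs (p * q) <= k).
    { intros p q k Hp Hq. rewrite Rabs_mult. assert (P1 := Rabs_pos p).
      assert (P2 := Rabs_pos q). nra. }
    assert (BU : Rabs (U r t - u0) <= r * K).
    { replace (U r t - u0) with (r * (a0 * c) + r * (- b0 * z) + e1) by (rewrite EU; ring).
      eapply Rle_trans; [apply Rabs_triang|].
      eapply Rle_trans; [apply Rplus_le_compat_r, Rabs_triang|].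
      rewrite !(Rabs_mult r), (Rabs_pos_eq r) by lra.
      assert (Rabs (a0 * c) <= Rabs a0) by (apply prod_le; [apply Rle_refl|exact Hc1]).
      assert (Rabs (- b0 * z) <= Rabs b0)
        by (apply prod_le; [rewrite Rabs_Ropp; apply Rle_refl|exact Hz1]).
      unfold K. nra. }
    assert (BV : Rabs (V r t - v0) <= r * K).
    { replace (V r t - v0) with (r * (b0 * c) + r * (a0 * z) + e2) by (rewrite EV; ring).
      eapply Rle_trans; [apply Rabs_triang|].
      eapply Rle_trans; [apply Rplus_le_compat_r, Rabs_triang|].
      rewrite !(Rabs_mult r), (Rabs_pos_eq r) by lra.
      assert (Rabs (b0 * c) <= Rabs b0) by (apply prod_le; [apply Rle_refl|exact Hc1]).
      assert (Rabs (a0 * z) <= Rabs a0) by (apply prod_le; [apply Rle_refl|exact Hz1]).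
      unfold K. nra. }
    assert (HrK : r * K <= K) by nra.
    assert (BU' : Rabs (U r t) <= Rabs u0 + K).
    { replace (U r t) with (u0 + (U r t - u0)) by ring.
      eapply Rle_trans; [apply Rabs_triang|]. lra. }
    assert (BV' : Rabs (V r t) <= Rabs v0 + K).
    { replace (V r t) with (v0 + (V r t - v0)) by ring.
      eapply Rle_trans; [apply Rabs_triang|]. lra. }
    assert (EQ : Q r t = 2 / R * u0 - s * b0 + s / r * (u0 * z - v0 * c)
      + 2 / R * (U r t - u0) + (s * z * e1 - s * c * e2) / r
      + r / R ^ 2 * (U r t * (s * z) + V r t * (s * c))).
    { transitivity (2 / R * U r t + s / r * (U r t * z - V r t * c)
        + r / R ^ 2 * (U r t * (s * z) + V r t * (s * c))).
      { unfold Q. fold c z. field. lra. }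
      replace (U r t * z - V r t * c) with (u0 * z - v0 * c - r * b0 + (z * e1 - c * e2)).
      { field. lra. }
      rewrite EU, EV. replace (r * b0) with (r * b0 * (c * c + z * z)) by (rewrite Hcz; ring).
      ring. }
    assert (Hsz : Rabs (s * z) <= 1) by (apply prod_le; assumption).
    assert (Hsc : Rabs (s * c) <= 1) by (apply prod_le; assumption).
    assert (T1 : 2 / R * (U r t - u0) <= 2 / R * (r * K)).
    { apply Rmult_le_compat_l; [lra|]. eapply Rle_trans; [apply Rle_abs|exact BU]. }
    assert (T2 : (s * z * e1 - s * c * e2) / r <= 2 * e).
    { apply Rmult_le_reg_r with r; [exact Hr0|].
      replace ((s * z * e1 - s * c * e2) / r * r) with (e1 * (s * z) + (- e2) * (s * c))
        by (field; lra).
      assert (A1 : Rabs (e1 * (s * z)) <= e * r) by (apply prod_le; assumption).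
      assert (A2 : Rabs (- e2 * (s * c)) <= e * r)
        by (apply prod_le; [rewrite Rabs_Ropp|]; assumption).
      apply Rabs_le_between in A1. apply Rabs_le_between in A2. lra. }
    assert (T3 : r / R ^ 2 * (U r t * (s * z) + V r t * (s * c)) <=
                 r / R ^ 2 * (Rabs u0 + Rabs v0 + 2 * K)).
    { apply Rmult_le_compat_l; [apply Rmult_le_pos; lra|].
      assert (A1 := prod_le _ _ _ BU' Hsz). assert (A2 := prod_le _ _ _ BV' Hsc).
      apply Rabs_le_between in A1. apply Rabs_le_between in A2. lra. }
    assert (T4 : 2 / R * (r * K) + r / R ^ 2 * (Rabs u0 + Rabs v0 + 2 * K) = r * M)
      by (unfold M; field; lra).
    unfold G. fold c z. rewrite EQ. lra. }
  assert (HQR : forall t, 0 <= Q R t).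
  { intro t. assert (Hz1 := SIN_bound t).
    assert (Hsz : - 1 <= s * sin t).
    { apply Rabs_le_between in Hs. nra. }
    replace (Q R t) with (2 / R * (U R t * (1 + s * sin t))).
    - apply Rmult_le_pos; [lra|]. apply Rmult_le_pos; [apply Hpos|lra].
    - unfold Q. field. lra. }
  set (m := 2 / R * u0 - s * b0 + eta).
  assert (HG : is_RInt (fun t => - G t) 0 (2 * PI) (- (m * (2 * PI)))).
  { set (N := fun t => - (m * t + s / r * (- u0 * cos t - v0 * sin t))).
    replace (- (m * (2 * PI))) with (minus (N (2 * PI)) (N 0)).
    - apply (is_RInt_derive (V := R_CompleteNormedModule) N).
      + intros t _. unfold N, G. auto_derive; [exact I|]. fold m. ring.
      + intros t _. unfold G. apply continuity_pt_filterlim, derivable_continuous_pt.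
        eexists. apply is_derive_Reals. auto_derive; [exact I|reflexivity].
    - unfold N, minus, plus, opp; simpl. rewrite cos_2PI, sin_2PI, cos_0, sin_0. ring. }
  assert (HPI := PI_RGT_0).
  assert (Hle : - (m * (2 * PI)) <= 0).
  { rewrite <- Hcirc, <- (is_RInt_unique _ _ _ _ HG). apply RInt_le; [lra|eexists; exact HG| |].
    - apply (ex_RInt_continuous (V := R_CompleteNormedModule)). intros t _.
      assert (HcQ : forall r, 0 < r <= R -> continuous (fun t => Q r t) t).
      { intros r' Hr'. destruct (Hcr r' t Hr') as (a & b & Hab).
        destruct (polar_kernel_closed u v x0 y0 R s r' t a b ltac:(lra) HR Hab)
          as (pr & k & qt & _ & HQ).
        exact (differentiable_continuous_2 _ _ _ _ _ HQ). }
      apply (continuous_minus (V := R_NormedModule)); apply HcQ; lra.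
    - intros t _. specialize (HQr t). specialize (HQR t). lra. }
  assert (0 <= m).
  { apply Rmult_le_reg_r with (2 * PI); [lra|]. lra. }
  unfold m in *. lra.
Qed.
(** * Imaginary parts at the boundary *)

Lemma filterlim_R_iff {T : Type} (F : (T -> Prop) -> Prop) {FF : Filter F} (f : T -> R) (l : R) :
  filterlim f F (locally l) <-> forall eps, 0 < eps -> F (fun x => Rabs (f x - l) < eps).
Proof.
  split.
  - intros Hf eps Heps. apply (proj1 (filterlim_locally f l) Hf (mkposreal eps Heps)).
  - intros Hf. apply filterlim_locally. intro eps. apply (Hf eps (cond_pos eps)).
Qed.

Lemma at_left_1_iff (P : R -> Prop) :
  at_left 1 P <-> exists r0, 0 < r0 < 1 /\ forall r, r0 < r < 1 -> P r.
Proof.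
  split.
  - intros [d Hd]. exists (Rmax (/ 2) (1 - d)).
    assert (Hd0 := cond_pos d).
    assert (H1 := Rmax_l (/ 2) (1 - d)). assert (H2 := Rmax_r (/ 2) (1 - d)).
    assert (Rmax (/ 2) (1 - d) < 1) by (apply Rmax_lub_lt; lra).
    split; [lra|]. intros r Hr. apply Hd; [|lra].
    apply Rabs_def1; unfold minus, plus, opp; simpl; lra.
  - intros (r0 & H0 & Hr). assert (Hp : 0 < 1 - r0) by lra.
    exists (mkposreal _ Hp). intros r Hb Hr1. apply Hr. split; [|exact Hr1].
    apply Rabs_def2 in Hb. unfold minus, plus, opp in Hb; simpl in Hb. lra.
Qed.

(** By the gradient bound on discs of radius [(1 - r) / 2], the derivative of [v] along the
    radius is at most [4 u / (1 - r) = o((1 - r)^(-2))]; integrating, [v = o((1 - r)^(-1))]. *)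
Lemma imaginary_part_negligible (u v : R -> R -> R) :
  (forall x y, x ^ 2 + y ^ 2 < 1 -> exists a b, cauchy_riemann u v x y a b) ->
  (forall x y, x ^ 2 + y ^ 2 < 1 -> 0 <= u x y) ->
  filterlim (fun r => (1 - r) * u r 0) (at_left 1) (locally 0) ->
  filterlim (fun r => (1 - r) * v r 0) (at_left 1) (locally 0).
Proof.
  intros Hcr Hpos Hlim.
  assert (Hder : forall r, 0 < r < 1 -> exists b,
      is_derive (fun x => v x 0) r b /\ Rabs b <= 4 / (1 - r) * u r 0).
  { intros r Hr.
    assert (Hin : forall q t, 0 <= q <= (1 - r) / 2 ->
        (r + q * cos t) ^ 2 + (0 + q * sin t) ^ 2 < 1).
    { intros q t Hq.
      assert (E : (r + q * cos t) ^ 2 + (0 + q * sin t) ^ 2 = r ^ 2 + 2 * (r * q) * cos t + q ^ 2).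
      { transitivity (r ^ 2 + 2 * (r * q) * cos t + q ^ 2 * ((sin t)² + (cos t)²));
          [unfold Rsqr; ring|rewrite sin2_cos2; ring]. }
      rewrite E. assert (Hc := COS_bound t). assert (0 <= r * q) by nra. nra. }
    destruct (Hcr r 0) as (a & b & Hab).
    { specialize (Hin 0 0 ltac:(lra)). rewrite !Rmult_0_l, !Rplus_0_r in Hin. exact Hin. }
    exists b. split.
    - apply is_derive_Reals. replace b with (b * 1 + a * 0) by ring.
      apply (derivable_pt_lim_comp_2d v (fun x => x) (fun _ => 0));
        [apply Hab|apply derivable_pt_lim_id|apply derivable_pt_lim_const].
    - replace (4 / (1 - r)) with (2 / ((1 - r) / 2)) by (field; lra).
      apply (holomorphic_gradient_bound u v r 0 ((1 - r) / 2) a b).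
      + lra.
      + intros q t Hq. apply Hcr, Hin. lra.
      + intro t. apply Hpos, Hin. lra.
      + exact Hab. }
  apply filterlim_R_iff; [apply at_left_proper_filter|]. intros eps Heps.
  rewrite filterlim_R_iff in Hlim by apply at_left_proper_filter.
  specialize (Hlim (eps / 8) ltac:(lra)). apply at_left_1_iff in Hlim.
  destruct Hlim as (r0 & Hr0 & Hu).
  set (r1 := (r0 + 1) / 2). assert (Hr1 : r0 < r1 < 1) by (unfold r1; lra).
  set (e := eps / 2).
  assert (Hgrow : forall s r, Rabs s <= 1 -> r1 < r < 1 ->
      s * v r 0 <= s * v r1 0 + e / (1 - r)).
  { intros s r Hs Hr.
    set (w := fun x => s * v x 0 - e / (1 - x)).
    destruct (MVT_gen w r1 r (fun x => s * Derive (fun x => v x 0) x - e / (1 - x) ^ 2))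
      as (c & Hc & Heq).
    - intros x Hx. rewrite Rmin_left, Rmax_right in Hx by lra.
      destruct (Hder x ltac:(lra)) as (b & Hb & _).
      unfold w. auto_derive.
      + split; [exists b; exact Hb|]. split; [lra|exact I].
      + replace (Derive (fun x0 => v x0 0) x) with b by (symmetry; apply is_derive_unique, Hb).
        simpl. field. lra.
    - intros x Hx. rewrite Rmin_left, Rmax_right in Hx by lra.
      destruct (Hder x ltac:(lra)) as (b & Hb & _).
      apply derivable_continuous_pt. exists (s * b - e / (1 - x) ^ 2).
      apply is_derive_Reals. unfold w. auto_derive.
      + split; [exists b; exact Hb|]. split; [lra|exact I].
      + replace (Derive (fun x0 => v x0 0) x) with b by (symmetry; apply is_derive_unique, Hb).
        simpl. field. lra.
    - rewrite Rmin_left, Rmax_right in Hc by lra.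
      destruct (Hder c ltac:(lra)) as (b & Hb & Hbound).
      replace (Derive (fun x => v x 0) c) with b in Heq by (symmetry; apply is_derive_unique, Hb).
      specialize (Hu c ltac:(lra)). rewrite Rminus_0_r in Hu. apply Rabs_lt_between in Hu.
      assert (Hsb : s * b <= e / (1 - c) ^ 2).
      { apply Rle_trans with (Rabs b).
        - eapply Rle_trans; [apply Rle_abs|]. rewrite Rabs_mult.
          assert (B := Rabs_pos b). nra.
        - eapply Rle_trans; [exact Hbound|].
          replace (4 / (1 - c) * u c 0) with (4 * ((1 - c) * u c 0) / (1 - c) ^ 2) by (field; lra).
          apply Rmult_le_compat_r; [left; apply Rinv_0_lt_compat, pow_lt; lra|].
          unfold e. lra. }
      assert (Hle : w r - w r1 <= 0) by (rewrite Heq; nra).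
      assert (0 <= e / (1 - r1)) by (apply Rlt_le, Rdiv_lt_0_compat; unfold e; lra).
      unfold w in Hle. lra. }
  set (B := Rabs (v r1 0) + 1).
  assert (HB : 0 < B) by (unfold B; assert (P := Rabs_pos (v r1 0)); lra).
  apply at_left_1_iff. exists (Rmax r1 (1 - e / B)).
  assert (HeB : 0 < e / B) by (apply Rdiv_lt_0_compat; unfold e; lra).
  assert (M1 := Rmax_l r1 (1 - e / B)). assert (M2 := Rmax_r r1 (1 - e / B)).
  assert (M3 : Rmax r1 (1 - e / B) < 1) by (apply Rmax_lub_lt; lra).
  split; [lra|]. intros r Hr.
  assert (Hsmall : (1 - r) * B < e).
  { assert (Hlt : 1 - r < e / B) by lra. apply Rmult_lt_compat_r with (r := B) in Hlt; [|exact HB].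
    replace (e / B * B) with e in Hlt by (field; lra). exact Hlt. }
  assert (Hone : forall s, Rabs s <= 1 -> (1 - r) * (s * v r 0) < eps).
  { intros s Hs. specialize (Hgrow s r Hs ltac:(lra)).
    apply Rmult_le_compat_l with (r := 1 - r) in Hgrow; [|lra].
    assert (s * v r1 0 <= B).
    { eapply Rle_trans; [apply Rle_abs|]. rewrite Rabs_mult. unfold B.
      assert (P := Rabs_pos (v r1 0)). nra. }
    replace ((1 - r) * (s * v r1 0 + e / (1 - r))) with ((1 - r) * (s * v r1 0) + e) in Hgrow
      by (field; lra).
    assert ((1 - r) * (s * v r1 0) <= (1 - r) * B) by (apply Rmult_le_compat_l; lra).
    unfold e in *. lra. }
  rewrite Rminus_0_r. apply Rabs_def1.
  - specialize (Hone 1). rewrite Rabs_R1 in Hone. lra.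
  - specialize (Hone (Ropp 1)). rewrite Rabs_Ropp, Rabs_R1 in Hone. lra.
Qed.
(** * Inner products *)

Lemma Cmod_sq (c : C) : Cmod c ^ 2 = Re c ^ 2 + Im c ^ 2.
Proof. apply Cmod2_alt. Qed.

Lemma inner_conj_Re {H : HilbertSpace} (x y : H) : Re (inner y x) = Re (inner x y).
Proof. rewrite inner_conj. reflexivity. Qed.

Lemma inner_plus_r {H : HilbertSpace} (x y z : H) :
  inner x (plus y z) = Cplus (inner x y) (inner x z).
Proof.
  rewrite (inner_conj _ (plus y z) x), inner_plus_l, Cplus_conj, <- !inner_conj. reflexivity.
Qed.

Lemma inner_scal_r {H : HilbertSpace} (a : C) (x y : H) :
  inner x (scal a y) = Cmult (Cconj a) (inner x y).
Proof.
  rewrite (inner_conj _ (scal a y) x), inner_scal_l, Cmult_conj, <- inner_conj. reflexivity.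
Qed.

Lemma inner_minus_l {H : HilbertSpace} (x y z : H) :
  inner (minus x y) z = Cminus (inner x z) (inner y z).
Proof.
  assert (E : minus x y = plus x (scal (opp one) y)) by (rewrite scal_opp_one; reflexivity).
  rewrite E, inner_plus_l, inner_scal_l. apply injective_projections; simpl; ring.
Qed.

Lemma inner_minus_r {H : HilbertSpace} (x y z : H) :
  inner x (minus y z) = Cminus (inner x y) (inner x z).
Proof.
  rewrite (inner_conj _ (minus y z) x), inner_minus_l, Cminus_conj, <- !inner_conj. reflexivity.
Qed.

Lemma inner_self {H : HilbertSpace} (x : H) : inner x x = (norm x ^ 2, 0).
Proof. apply inner_norm. Qed.

Lemma norm_sq_Re {H : HilbertSpace} (x : H) : norm x ^ 2 = Re (inner x x).
Proof. rewrite inner_self. reflexivity. Qed.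

Lemma norm_minus_sq {H : HilbertSpace} (x y : H) :
  norm (minus x y) ^ 2 = norm x ^ 2 - 2 * Re (inner x y) + norm y ^ 2.
Proof.
  rewrite !norm_sq_Re, inner_minus_l, !inner_minus_r.
  assert (E := inner_conj_Re x y). unfold Re in *. simpl. lra.
Qed.

Lemma norm_plus_sq {H : HilbertSpace} (x y : H) :
  norm (plus x y) ^ 2 = norm x ^ 2 + 2 * Re (inner x y) + norm y ^ 2.
Proof.
  rewrite !norm_sq_Re, inner_plus_l, !inner_plus_r.
  assert (E := inner_conj_Re x y). unfold Re in *. simpl. lra.
Qed.

Lemma norm_scal_sq {H : HilbertSpace} (a : C) (x : H) :
  norm (scal a x) ^ 2 = Cmod a ^ 2 * norm x ^ 2.
Proof.
  rewrite norm_sq_Re, inner_scal_l, inner_scal_r, inner_self, Cmod_sq.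
  unfold Re, Im; simpl. ring.
Qed.

Lemma norm_scal_eq {H : HilbertSpace} (a : C) (x : H) : norm (scal a x) = Cmod a * norm x.
Proof.
  apply Rsqr_inj; [apply norm_ge_0|apply Rmult_le_pos; [apply Cmod_ge_0|apply norm_ge_0]|].
  rewrite !Rsqr_pow2, norm_scal_sq. ring.
Qed.

Lemma cauchy_schwarz {H : HilbertSpace} (x y : H) :
  Re (inner x y) ^ 2 + Im (inner x y) ^ 2 <= norm x ^ 2 * norm y ^ 2.
Proof.
  set (p := Re (inner x y)). set (q := Im (inner x y)).
  set (a := scal (RtoC (norm y ^ 2)) x : H). set (b := scal (inner x y) y : H).
  assert (E : norm (minus a b) ^ 2 =
    norm y ^ 2 * (norm x ^ 2 * norm y ^ 2 - (p ^ 2 + q ^ 2))).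
  { unfold a, b. rewrite norm_minus_sq, !norm_scal_sq, inner_scal_l, inner_scal_r, !Cmod_sq.
    fold p q. unfold p, q, Re, Im; simpl. ring. }
  assert (H0 := pow2_ge_0 (norm (minus a b))).
  rewrite E in H0.
  destruct (norm_ge_0 y) as [Hy|Hy].
  - apply Rmult_le_reg_l with (norm y ^ 2); [apply pow_lt, Hy|]. lra.
  - assert (Hz : y = zero) by (apply (norm_eq_zero (V := hilbert_carrier H)); auto).
    assert (Hxy : inner x y = 0).
    { assert (Hy0 : scal (RtoC 0) y = y) by (rewrite Hz; exact (scal_zero_r (K := C_AbsRing) (V := hilbert_carrier H) _)).
      rewrite <- Hy0, inner_scal_r. apply injective_projections; simpl; ring. }
    unfold p, q. rewrite Hxy, <- Hy. unfold Re, Im; simpl. lra.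
Qed.

Lemma Cmod_inner_le {H : HilbertSpace} (x y : H) : Cmod (inner x y) <= norm x * norm y.
Proof.
  apply Rsqr_incr_0; [|apply Cmod_ge_0|apply Rmult_le_pos; apply norm_ge_0].
  rewrite !Rsqr_pow2, Rpow_mult_distr, Cmod_sq. apply cauchy_schwarz.
Qed.

(** Polarization reduces the continuity of the inner product to that of the norm. *)
Lemma filterlim_Re_inner {T : Type} {H : HilbertSpace} (F : (T -> Prop) -> Prop) {FF : Filter F}
    (k l : T -> H) (x y : H) :
  filterlim k F (locally x) -> filterlim l F (locally y) ->
  filterlim (fun t => Re (inner (k t) (l t))) F (locally (Re (inner x y))).
Proof.
  intros Hk Hl.
  assert (Hn : forall m (z : H), filterlim m F (locally z) ->
      filterlim (fun t => norm (m t) ^ 2) F (locally (norm z ^ 2))).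
  { intros m z Hm. apply (filterlim_comp _ _ _ m (fun z => norm z ^ 2) F (locally z)); [exact Hm|].
    apply (filterlim_comp _ _ _ (fun z : H => norm z) (fun r : R => r ^ 2) _ (locally (norm z))).
    - exact (filterlim_norm (V := hilbert_carrier H) z).
    - apply continuity_pt_filterlim, derivable_continuous_pt, derivable_pt_pow. }
  assert (HP := Hn _ _ (filterlim_comp_2 k l plus Hk Hl (filterlim_plus x y))).
  assert (E : forall a b : H, Re (inner a b) = / 2 * (norm (plus a b) ^ 2 + -1 * norm a ^ 2 +
      -1 * norm b ^ 2)) by (intros a b; rewrite norm_plus_sq; field).
  rewrite E. apply filterlim_ext with (f := fun t => / 2 * (norm (plus (k t) (l t)) ^ 2 +
      -1 * norm (k t) ^ 2 + -1 * norm (l t) ^ 2)); [intro t; symmetry; apply E|].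
  assert (Hc : forall (c : R) (m : T -> R) z, filterlim m F (locally z) ->
      filterlim (fun t => c * m t) F (locally (c * z))).
  { intros c m z Hm. apply (filterlim_comp _ _ _ m (Rmult c) F (locally z)); [exact Hm|].
    apply (filterlim_scal_r (V := R_NormedModule) c z). }
  apply Hc. eapply filterlim_comp_2; [|apply Hc, Hn, Hl|apply (filterlim_plus (V := R_NormedModule))].
  eapply filterlim_comp_2; [exact HP|apply Hc, Hn, Hk|apply (filterlim_plus (V := R_NormedModule))].
Qed.

Lemma filterlim_Im_inner {T : Type} {H : HilbertSpace} (F : (T -> Prop) -> Prop) {FF : Filter F}
    (k l : T -> H) (x y : H) :
  filterlim k F (locally x) -> filterlim l F (locally y) ->
  filterlim (fun t => Im (inner (k t) (l t))) F (locally (Im (inner x y))).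
Proof.
  intros Hk Hl.
  assert (E : forall a b : H, Im (inner a b) = Re (inner a (scal Ci b))).
  { intros a b. rewrite inner_scal_r. unfold Re, Im; simpl. ring. }
  rewrite E. apply filterlim_ext with (f := fun t => Re (inner (k t) (scal Ci (l t))));
    [intro t; symmetry; apply E|].
  apply filterlim_Re_inner; [exact FF|exact Hk|].
  apply (filterlim_comp _ _ _ l (scal Ci) F (locally y)); [exact Hl|].
  exact (filterlim_scal_r (K := C_AbsRing) (V := hilbert_carrier H) Ci y).
Qed.
(** * The hyperbolic metric *)

Lemma Cmod_one_minus_sq (c : C) : Cmod (Cminus 1 c) ^ 2 = (1 - Re c) ^ 2 + Im c ^ 2.
Proof. rewrite Cmod_sq. unfold Re, Im; simpl. ring. Qed.

Lemma Re_inner_lt_1 {H : HilbertSpace} (x y : H) :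
  norm x < 1 -> norm y <= 1 -> Re (inner x y) < 1.
Proof.
  intros Hx Hy. apply Rle_lt_trans with (norm x * norm y).
  - eapply Rle_trans; [apply Rle_abs|]. eapply Rle_trans; [apply re_le_Cmod|apply Cmod_inner_le].
  - assert (H0 := norm_ge_0 x). assert (H1 := norm_ge_0 y). nra.
Qed.

Lemma norm_sq_lt_1 {H : HilbertSpace} (x : H) : norm x < 1 -> norm x ^ 2 < 1.
Proof. intro Hx. assert (H0 := norm_ge_0 x). simpl. nra. Qed.

Lemma one_minus_inner_sq_pos {H : HilbertSpace} (x y : H) :
  norm x < 1 -> norm y <= 1 -> 0 < Cmod (Cminus 1 (inner x y)) ^ 2.
Proof.
  intros Hx Hy. rewrite Cmod_one_minus_sq.
  assert (H0 := Re_inner_lt_1 x y Hx Hy). assert (H1 := pow2_ge_0 (Im (inner x y))).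
  assert (0 < (1 - Re (inner x y)) ^ 2) by (apply pow_lt; lra). lra.
Qed.

(** The numerator of [1 - sigma w z] is [|w - z|^2] minus the Gram determinant of [w - z] and
    [z], which is at most [|w - z|^2 * |z|^2]. *)
Lemma sigma_gap {H : HilbertSpace} (w z : H) : unit_ball w -> unit_ball z ->
  (1 - norm z ^ 2) * norm (minus w z) ^ 2 <= 4 * (1 - sigma w z).
Proof.
  unfold unit_ball. intros Hw Hz.
  assert (Hd := one_minus_inner_sq_pos w z Hw (Rlt_le _ _ Hz)).
  assert (Hd4 : Cmod (Cminus 1 (inner w z)) ^ 2 <= 4).
  { assert (Hd2 : Cmod (Cminus 1 (inner w z)) <= 2).
    { eapply Rle_trans; [apply Cmod_triangle|]. rewrite Cmod_1, Cmod_opp.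
      assert (H0 := Cmod_inner_le w z). assert (H1 := norm_ge_0 w). assert (H2 := norm_ge_0 z). nra. }
    assert (H0 := Cmod_ge_0 (Cminus 1 (inner w z))). simpl. nra. }
  assert (Hgap : (1 - norm z ^ 2) * norm (minus w z) ^ 2 <=
     Cmod (Cminus 1 (inner w z)) ^ 2 - (1 - norm w ^ 2) * (1 - norm z ^ 2)).
  { rewrite Cmod_one_minus_sq, norm_minus_sq.
    assert (S1 := pow2_ge_0 (Re (inner w z) - norm z ^ 2)).
    assert (S2 := pow2_ge_0 (Im (inner w z))).
    lra. }
  assert (E : Cmod (Cminus 1 (inner w z)) ^ 2 - (1 - norm w ^ 2) * (1 - norm z ^ 2) =
    (1 - sigma w z) * Cmod (Cminus 1 (inner w z)) ^ 2) 
    by (unfold sigma; field; intro E0; rewrite E0 in Hd; simpl in Hd; lra).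
  rewrite E in Hgap.
  assert (H0 : 0 <= (1 - norm z ^ 2) * norm (minus w z) ^ 2).
  { apply Rmult_le_pos; [|apply pow2_ge_0]. apply norm_sq_lt_1 in Hz. lra. }
  assert (0 <= 1 - sigma w z).
  { apply Rmult_le_reg_r with (1 := Hd). lra. }
  nra.
Qed.

Lemma sigma_pos {H : HilbertSpace} (x y : H) : unit_ball x -> unit_ball y -> 0 < sigma x y.
Proof.
  unfold unit_ball. intros Hx Hy. apply Rdiv_lt_0_compat.
  - apply norm_sq_lt_1 in Hx. apply norm_sq_lt_1 in Hy. apply Rmult_lt_0_compat; lra.
  - apply one_minus_inner_sq_pos; lra.
Qed.

Lemma sigma_le_1 {H : HilbertSpace} (x y : H) : unit_ball x -> unit_ball y -> sigma x y <= 1.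
Proof.
  intros Hx Hy. assert (Hg := sigma_gap x y Hx Hy).
  assert (0 <= (1 - norm y ^ 2) * norm (minus x y) ^ 2).
  { apply Rmult_le_pos; [|apply pow2_ge_0]. apply norm_sq_lt_1 in Hy. lra. }
  lra.
Qed.

Lemma artanh_increasing (p q : R) : 0 <= p -> p < q -> q < 1 -> artanh p < artanh q.
Proof.
  intros Hp Hpq Hq. unfold artanh. apply Rmult_lt_compat_l; [lra|].
  apply ln_increasing; [apply Rdiv_lt_0_compat; lra|].
  apply Rmult_lt_reg_r with ((1 - p) * (1 - q)); [apply Rmult_lt_0_compat; lra|].
  replace ((1 + p) / (1 - p) * ((1 - p) * (1 - q))) with ((1 + p) * (1 - q)) by (field; lra).
  replace ((1 + q) / (1 - q) * ((1 - p) * (1 - q))) with ((1 + q) * (1 - p)) by (field; lra).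
  lra.
Qed.

Lemma rho_le_sigma_ge {H : HilbertSpace} (x y x' y' : H) :
  unit_ball x -> unit_ball y -> unit_ball x' -> unit_ball y' ->
  rho x' y' <= rho x y -> sigma x y <= sigma x' y'.
Proof.
  intros Hx Hy Hx' Hy' Hrho. apply Rnot_lt_le. intro Hlt.
  revert Hrho. apply Rlt_not_le. unfold rho.
  assert (H1 := sigma_le_1 x y Hx Hy). assert (H2 := sigma_pos x' y' Hx' Hy').
  apply artanh_increasing.
  - apply sqrt_pos.
  - apply sqrt_lt_1; lra.
  - apply Rlt_le_trans with (sqrt 1); [apply sqrt_lt_1; lra|rewrite sqrt_1; apply Rle_refl].
Qed.

(** * One-sided derivatives along curves *)

Definition right_derivative (phi : R -> R) (l : R) : Prop :=
  filterlim (fun t => (phi t - phi 0) / t) (at_right 0) (locally l).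

Lemma at_right_pos (P : R -> Prop) : (forall t, 0 < t -> P t) -> at_right 0 P.
Proof. intros HP. exists (mkposreal 1 Rlt_0_1). intros t _ Ht. apply HP, Ht. Qed.

Lemma filterlim_at_right_ext {T : UniformSpace} (g h : R -> T) (l : T) :
  (forall t, 0 < t -> g t = h t) ->
  filterlim g (at_right 0) (locally l) -> filterlim h (at_right 0) (locally l).
Proof.
  intros E. apply filterlim_ext_loc. apply at_right_pos, E.
Qed.

(** Prolonging a function linearly to the left of [0] makes its right derivative an ordinary
    derivative, so that the two-sided rules of calculus apply. *)
Lemma right_derivative_extension (phi : R -> R) (l : R) : right_derivative phi l ->
  exists psi, (forall t, 0 <= t -> psi t = phi t) /\ is_derive psi 0 l.
Proof.
  intro Hphi. set (psi := fun t => if Rle_dec 0 t then phi t else phi 0 + l * t).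
  assert (E : forall t, 0 <= t -> psi t = phi t)
    by (intros t Ht; unfold psi; destruct (Rle_dec 0 t); [reflexivity|contradiction]).
  exists psi. split; [exact E|]. apply is_derive_Reals. intros eps Heps.
  unfold right_derivative in Hphi. rewrite filterlim_R_iff in Hphi by apply at_right_proper_filter.
  destruct (Hphi eps Heps) as [d Hd]. exists d. intros h Hh Hhd.
  rewrite Rplus_0_l. destruct (Rtotal_order h 0) as [Hneg|[H0|Hpos]]; [|contradiction|].
  - replace ((psi h - psi 0) / h - l) with 0; [rewrite Rabs_R0; exact Heps|].
    rewrite (E 0 (Rle_refl 0)). unfold psi. destruct (Rle_dec 0 h); [lra|]. field. exact Hh.
  - rewrite !E by lra. apply (Hd h); [|exact Hpos].
    change (Rabs (h - 0) < d). rewrite Rminus_0_r. exact Hhd.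
Qed.

Lemma is_derive_right_derivative (phi psi : R -> R) (l : R) :
  (forall t, 0 <= t -> psi t = phi t) -> is_derive psi 0 l -> right_derivative phi l.
Proof.
  intros E Hpsi. apply filterlim_R_iff; [apply at_right_proper_filter|]. intros eps Heps.
  apply is_derive_Reals in Hpsi. destruct (Hpsi eps Heps) as [d Hd]. exists d.
  intros t Ht Hpos. rewrite <- !E by lra. specialize (Hd t ltac:(lra)).
  rewrite Rplus_0_l in Hd. apply Hd.
  change (Rabs (t - 0) < d) in Ht. rewrite Rminus_0_r in Ht. exact Ht.
Qed.

Lemma right_derivative_nonneg (phi : R -> R) (l : R) :
  right_derivative phi l -> (forall t, 0 < t -> phi 0 <= phi t) -> 0 <= l.
Proof.
  intros Hphi Hge. apply Rnot_lt_le. intro Hl.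
  unfold right_derivative in Hphi. rewrite filterlim_R_iff in Hphi by apply at_right_proper_filter.
  assert (HF : at_right 0 (fun t => 0 < t)) by (apply at_right_pos; auto).
  assert (Hex := filter_and (F := at_right 0) _ _ (Hphi (- l) ltac:(lra)) HF).
  apply (filter_ex (F := at_right 0)) in Hex. destruct Hex as (t & Habs & Ht).
  apply Rabs_def2 in Habs.
  assert (0 <= (phi t - phi 0) / t).
  { apply Rmult_le_pos; [specialize (Hge t Ht); lra|left; apply Rinv_0_lt_compat, Ht]. }
  lra.
Qed.

(** The sign is that of generators: the curve leaves [X 0] with velocity [- k]. *)
Definition curve_slope {H : HilbertSpace} (X : R -> H) (k : H) : Prop :=
  filterlim X (at_right 0) (locally (X 0)) /\
  filterlim (fun t => scal (RtoC (/ t)) (minus (X 0) (X t))) (at_right 0) (locally k).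

Lemma curve_slope_const {H : HilbertSpace} (y : H) : curve_slope (fun _ => y) zero.
Proof.
  split; [apply filterlim_const|].
  apply filterlim_ext with (f := fun _ => (zero : H)); [|apply filterlim_const].
  intro t. replace (minus y y) with (zero : H) by (symmetry; exact (minus_eq_zero y)).
  symmetry. exact (scal_zero_r (K := C_AbsRing) (V := hilbert_carrier H) _).
Qed.

Lemma inner_zero_r {H : HilbertSpace} (x : H) : inner x zero = 0.
Proof.
  assert (E : scal (RtoC 0) zero = (zero : H))
    by exact (scal_zero_r (K := C_AbsRing) (V := hilbert_carrier H) _).
  rewrite <- E, inner_scal_r. apply injective_projections; simpl; ring.
Qed.

Lemma right_derivative_Re_inner {H : HilbertSpace} (X Y : R -> H) (k l : H) :
  curve_slope X k -> curve_slope Y l ->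
  right_derivative (fun t => Re (inner (X t) (Y t))) (- Re (inner k (Y 0)) - Re (inner (X 0) l)).
Proof.
  intros [_ HX] [HY0 HY].
  assert (L1 := filterlim_Re_inner _ _ _ _ _ HX HY0).
  assert (L2 := filterlim_Re_inner _ _ _ _ _ (filterlim_const (X 0)) HY).
  assert (E : - Re (inner k (Y 0)) - Re (inner (X 0) l) =
    plus (opp (Re (inner k (Y 0)))) (opp (Re (inner (X 0) l)))) by reflexivity.
  unfold right_derivative. rewrite E. eapply filterlim_at_right_ext.
  2:{ eapply filterlim_comp_2; [| |apply (filterlim_plus (V := R_NormedModule))].
      - eapply filterlim_comp; [exact L1|apply (filterlim_opp (V := R_NormedModule))].
      - eapply filterlim_comp; [exact L2|apply (filterlim_opp (V := R_NormedModule))]. }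
  intros t Ht. cbv beta. rewrite inner_scal_l, inner_scal_r, inner_minus_l, inner_minus_r.
  unfold plus, opp, Re; simpl. field. lra.
Qed.

Lemma right_derivative_Im_inner {H : HilbertSpace} (X Y : R -> H) (k l : H) :
  curve_slope X k -> curve_slope Y l ->
  right_derivative (fun t => Im (inner (X t) (Y t))) (- Im (inner k (Y 0)) - Im (inner (X 0) l)).
Proof.
  intros [_ HX] [HY0 HY].
  assert (L1 := filterlim_Im_inner _ _ _ _ _ HX HY0).
  assert (L2 := filterlim_Im_inner _ _ _ _ _ (filterlim_const (X 0)) HY).
  assert (E : - Im (inner k (Y 0)) - Im (inner (X 0) l) =
    plus (opp (Im (inner k (Y 0)))) (opp (Im (inner (X 0) l)))) by reflexivity.
  unfold right_derivative. rewrite E. eapply filterlim_at_right_ext.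
  2:{ eapply filterlim_comp_2; [| |apply (filterlim_plus (V := R_NormedModule))].
      - eapply filterlim_comp; [exact L1|apply (filterlim_opp (V := R_NormedModule))].
      - eapply filterlim_comp; [exact L2|apply (filterlim_opp (V := R_NormedModule))]. }
  intros t Ht. cbv beta. rewrite inner_scal_l, inner_scal_r, inner_minus_l, inner_minus_r.
  unfold plus, opp, Im; simpl. field. lra.
Qed.

Lemma right_derivative_norm_sq {H : HilbertSpace} (X : R -> H) (k : H) :
  curve_slope X k -> right_derivative (fun t => norm (X t) ^ 2) (- 2 * Re (inner k (X 0))).
Proof.
  intro HX. assert (HD := right_derivative_Re_inner X X k k HX HX).
  replace (- 2 * Re (inner k (X 0))) with (- Re (inner k (X 0)) - Re (inner (X 0) k))
    by (rewrite (inner_conj_Re k (X 0)); ring).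
  unfold right_derivative in *. eapply filterlim_at_right_ext; [|exact HD].
  intros t _. cbv beta. rewrite !norm_sq_Re. reflexivity.
Qed.
(** * Generators *)

Lemma Re_Cdiv (n d : C) : Re (Cdiv n d) = (Re n * Re d + Im n * Im d) / (Re d ^ 2 + Im d ^ 2).
Proof. unfold Re, Im, Cdiv; simpl. unfold Rdiv. ring. Qed.

Lemma semigroup_at_0 {H : HilbertSpace} (F : R -> H -> H) (x : H) :
  continuous_semigroup F -> unit_ball x -> F 0 x = x.
Proof.
  intros (Hself & Hadd & Hcont) Hx.
  assert (Hx0 : unit_ball (F 0 x)) by (apply (Hself 0 (Rle_refl 0)), Hx).
  assert (L : filterlim (fun t => F t x) (at_right 0) (locally (F 0 x))).
  { eapply filterlim_at_right_ext; [|exact (Hcont _ Hx0)].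
    intros t Ht. cbv beta. rewrite <- Hadd by (try lra; exact Hx). rewrite Rplus_0_r. reflexivity. }
  exact (filterlim_locally_unique (V := hilbert_carrier H) _ _ _ L (Hcont x Hx)).
Qed.

Lemma semigroup_slope {H : HilbertSpace} (F : R -> H -> H) (f : H -> H) (x : H) :
  continuous_semigroup F -> generated_by F f -> unit_ball x -> curve_slope (fun t => F t x) (f x).
Proof.
  intros HF Hgen Hx. assert (H0 := semigroup_at_0 F x HF Hx).
  split; rewrite H0; [apply HF, Hx|apply Hgen, Hx].
Qed.

(** Since [sigma (X t) (Y t)] is least at [t = 0], its right derivative there is nonnegative. *)
Lemma sigma_increasing_slopes {H : HilbertSpace} (X Y : R -> H) (k l : H) :
  curve_slope X k -> curve_slope Y l ->
  (forall t, 0 <= t -> unit_ball (X t)) -> (forall t, 0 <= t -> unit_ball (Y t)) ->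
  (forall t, 0 < t -> sigma (X 0) (Y 0) <= sigma (X t) (Y t)) ->
  Re (Cdiv (Cplus (inner k (Y 0)) (inner (X 0) l)) (Cminus 1 (inner (X 0) (Y 0)))) <=
  Re (inner k (X 0)) / (1 - norm (X 0) ^ 2) + Re (inner l (Y 0)) / (1 - norm (Y 0) ^ 2).
Proof.
  intros HX HY HBX HBY Hsigma.
  destruct (right_derivative_extension _ _ (right_derivative_norm_sq X k HX)) as (A & EA & DA).
  destruct (right_derivative_extension _ _ (right_derivative_norm_sq Y l HY)) as (B & EB & DB).
  destruct (right_derivative_extension _ _ (right_derivative_Re_inner X Y k l HX HY))
    as (p & Ep & Dp).
  destruct (right_derivative_extension _ _ (right_derivative_Im_inner X Y k l HX HY))
    as (q & Eq & Dq).
  assert (HA : forall t, 0 <= t -> 0 < 1 - A t).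
  { intros t Ht. rewrite EA by exact Ht. assert (HB := norm_sq_lt_1 _ (HBX t Ht)). lra. }
  assert (HB : forall t, 0 <= t -> 0 < 1 - B t).
  { intros t Ht. rewrite EB by exact Ht. assert (HC := norm_sq_lt_1 _ (HBY t Ht)). lra. }
  assert (HD : forall t, 0 <= t -> 0 < (1 - p t) ^ 2 + q t ^ 2).
  { intros t Ht. rewrite Ep, Eq, <- Cmod_one_minus_sq by exact Ht.
    apply one_minus_inner_sq_pos; [apply HBX, Ht|left; apply HBY, Ht]. }
  set (N := (1 - A 0) * (1 - B 0)). set (D := (1 - p 0) ^ 2 + q 0 ^ 2).
  set (phi := fun t => (1 - A t) * (1 - B t) * D - N * ((1 - p t) ^ 2 + q t ^ 2)).
  assert (Hphi : forall t, 0 < t -> phi 0 <= phi t).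
  { intros t Ht. specialize (Hsigma t Ht). unfold sigma in Hsigma.
    rewrite !Cmod_one_minus_sq, <- !EA, <- !EB, <- !Ep, <- !Eq in Hsigma by lra.
    fold N D in Hsigma. unfold phi. fold N D.
    assert (D0 : 0 < D) by (apply HD; lra). assert (Dt := HD t ltac:(lra)).
    set (Dt' := (1 - p t) ^ 2 + q t ^ 2) in *.
    apply Rmult_le_compat_r with (r := D * Dt') in Hsigma;
      [|apply Rlt_le, Rmult_lt_0_compat; assumption].
    replace (N / D * (D * Dt')) with (N * Dt') in Hsigma by (field; lra).
    replace ((1 - A t) * (1 - B t) / Dt' * (D * Dt')) with ((1 - A t) * (1 - B t) * D) in Hsigma
      by (field; lra).
    lra. }
  set (a := Re (inner (X 0) (Y 0))) in *. set (b := Im (inner (X 0) (Y 0))) in *.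
  assert (Hder : is_derive phi 0
    ((2 * Re (inner k (X 0)) * (1 - B 0) + 2 * Re (inner l (Y 0)) * (1 - A 0)) * D -
     2 * N * ((1 - p 0) * (Re (inner k (Y 0)) + Re (inner (X 0) l))
              - q 0 * (Im (inner k (Y 0)) + Im (inner (X 0) l))))).
  { unfold phi. auto_derive.
    - repeat split; eexists; eassumption.
    - replace (Derive (fun x => A x) 0) with (- 2 * Re (inner k (X 0)))
        by (symmetry; apply is_derive_unique, DA).
      replace (Derive (fun x => B x) 0) with (- 2 * Re (inner l (Y 0)))
        by (symmetry; apply is_derive_unique, DB).
      replace (Derive (fun x => p x) 0) with (- Re (inner k (Y 0)) - Re (inner (X 0) l))
        by (symmetry; apply is_derive_unique, Dp).
      replace (Derive (fun x => q x) 0) with (- Im (inner k (Y 0)) - Im (inner (X 0) l))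
        by (symmetry; apply is_derive_unique, Dq).
      ring. }
  assert (Hge := right_derivative_nonneg phi _
    (is_derive_right_derivative phi phi _ (fun _ _ => eq_refl) Hder) Hphi).
  assert (HN1 := HA 0 (Rle_refl 0)). assert (HN2 := HB 0 (Rle_refl 0)).
  assert (HD0 := HD 0 (Rle_refl 0)). fold D in HD0.
  rewrite Re_Cdiv.
  replace (Re (Cminus 1 (inner (X 0) (Y 0)))) with (1 - p 0)
    by (rewrite Ep by lra; unfold Re; simpl; ring).
  replace (Im (Cminus 1 (inner (X 0) (Y 0)))) with (- q 0)
    by (rewrite Eq by lra; unfold Im; simpl; ring).
  rewrite <- EA, <- EB by lra.
  replace ((1 - p 0) ^ 2 + (- q 0) ^ 2) with D by (unfold D; ring).
  apply Rmult_le_reg_r with (2 * N * D).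
  { unfold N. repeat apply Rmult_lt_0_compat; lra. }
  assert (HN : N <> 0) by (unfold N; nra).
  match goal with |- ?L * _ <= ?Q * _ =>
    replace (L * (2 * N * D)) with (2 * N * ((1 - p 0) * (Re (inner k (Y 0)) + Re (inner (X 0) l))
              - q 0 * (Im (inner k (Y 0)) + Im (inner (X 0) l))));
    [replace (Q * (2 * N * D)) with
      ((2 * Re (inner k (X 0)) * (1 - B 0) + 2 * Re (inner l (Y 0)) * (1 - A 0)) * D)|]
  end.
  - lra.
  - unfold N. field. lra.
  - unfold Re, Im; simpl. field. lra.
Qed.

(** The infinitesimal form of the contraction property of the semigroup for [rho]. *)
Lemma generator_rho_monotone {H : HilbertSpace} (F : R -> H -> H) (f : H -> H) (x y : H) :
  continuous_semigroup F -> (forall t, 0 <= t -> rho_nonexpansive (F t)) -> generated_by F f ->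
  unit_ball x -> unit_ball y ->
  Re (Cdiv (Cplus (inner (f x) y) (inner x (f y))) (Cminus 1 (inner x y))) <=
  Re (inner (f x) x) / (1 - norm x ^ 2) + Re (inner (f y) y) / (1 - norm y ^ 2).
Proof.
  intros HF Hrho Hgen Hx Hy.
  assert (Hself : forall t z, 0 <= t -> unit_ball z -> unit_ball (F t z))
    by (intros t z Ht; apply (proj1 HF t Ht)).
  assert (HM := sigma_increasing_slopes _ _ _ _ (semigroup_slope F f x HF Hgen Hx)
    (semigroup_slope F f y HF Hgen Hy)).
  cbv beta in HM. rewrite !(semigroup_at_0 F) in HM by assumption. apply HM.
  - intros t Ht. apply Hself; assumption.
  - intros t Ht. apply Hself; assumption.
  - intros t Ht. apply Rlt_le in Ht.
    apply rho_le_sigma_ge; try apply Hself; try assumption. apply Hrho; assumption.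
Qed.
(** * Radial behaviour of the generator *)

Lemma filterlim_Rplus {T : Type} (F : (T -> Prop) -> Prop) {FF : Filter F} (g h : T -> R) (a b : R) :
  filterlim g F (locally a) -> filterlim h F (locally b) ->
  filterlim (fun t => g t + h t) F (locally (a + b)).
Proof.
  intros Hg Hh. exact (filterlim_comp_2 g h Rplus Hg Hh (filterlim_plus (V := R_NormedModule) a b)).
Qed.

Lemma filterlim_Rmult {T : Type} (F : (T -> Prop) -> Prop) {FF : Filter F} (g h : T -> R) (a b : R) :
  filterlim g F (locally a) -> filterlim h F (locally b) ->
  filterlim (fun t => g t * h t) F (locally (a * b)).
Proof.
  intros Hg Hh. exact (filterlim_comp_2 g h Rmult Hg Hh (filterlim_mult (K := R_AbsRing) a b)).
Qed.

Lemma filterlim_Rinv {T : Type} (F : (T -> Prop) -> Prop) {FF : Filter F} (g : T -> R) (a : R) :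
  a <> 0 -> filterlim g F (locally a) -> filterlim (fun t => / g t) F (locally (/ a)).
Proof.
  intros Ha Hg. apply (filterlim_comp _ _ _ g Rinv F (locally a)); [exact Hg|].
  apply continuous_Rinv, Ha.
Qed.

Lemma filterlim_at_left_id (a : R) : filterlim (fun r : R => r) (at_left a) (locally a).
Proof. intros P HP. apply filter_le_within, HP. Qed.

Ltac filterlim_arith :=
  lazymatch goal with
  | |- filterlim (fun t => @?g t + @?h t) ?F (locally (?a + ?b)) =>
      apply (filterlim_Rplus F g h a b); filterlim_arith
  | |- filterlim (fun t => @?g t * @?h t) ?F (locally (?a * ?b)) =>
      apply (filterlim_Rmult F g h a b); filterlim_arith
  | |- filterlim (fun t => / @?g t) ?F (locally (/ ?a)) =>
      apply (filterlim_Rinv F g a); [try lra|filterlim_arith]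
  | |- _ => first [eassumption | apply filterlim_const]
  end.

Lemma Re_inner_star {H : HilbertSpace} (tau v x : H) :
  Re (inner v (star tau x)) =
  Re (inner v x) / (1 - norm x ^ 2) - Re (Cdiv (inner v tau) (Cminus 1 (inner x tau))).
Proof.
  set (p := scal (RtoC (/ (1 - norm x ^ 2))) x : H).
  set (q := scal (Cinv (Cminus 1 (inner tau x))) tau : H).
  change (star tau x) with (minus p q). unfold p, q. rewrite inner_minus_r, !inner_scal_r, (inner_conj _ x tau), Re_Cdiv.
  unfold Re, Im, Cconj, Cinv, RtoC; simpl.
  set (a := fst (inner x tau)). set (b := snd (inner x tau)).
  replace ((1 + - a) * ((1 + - a) * 1) + (0 + - - b) * ((0 + - - b) * 1))
    with ((1 + - a) * ((1 + - a) * 1) + (0 + - b) * ((0 + - b) * 1)) by ring.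
  unfold Rdiv. ring.
Qed.

Lemma norm_radial {H : HilbertSpace} (tau : H) (r : R) :
  unit_sphere tau -> norm (scal (RtoC r) tau) = Rabs r.
Proof. intro Ht. rewrite norm_scal_eq, Ht, Cmod_R. ring. Qed.

Lemma unit_ball_radial {H : HilbertSpace} (tau : H) (r : R) :
  unit_sphere tau -> 0 < r < 1 -> unit_ball (scal (RtoC r) tau).
Proof. intros Ht Hr. unfold unit_ball. rewrite norm_radial, Rabs_pos_eq by (try exact Ht; lra). lra. Qed.

Lemma Re_radial_quotient {H : HilbertSpace} (f : H -> H) (tau : H) (r : R) : r <> 1 ->
  Re (radial_quotient f tau r) = Re (inner (f (scal (RtoC r) tau)) tau) / (r - 1).
Proof.
  intro Hr. unfold radial_quotient. rewrite Re_Cdiv. unfold Re, Im; simpl. field. lra.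
Qed.

Lemma Im_radial_quotient {H : HilbertSpace} (f : H -> H) (tau : H) (r : R) : r <> 1 ->
  Im (radial_quotient f tau r) = Im (inner (f (scal (RtoC r) tau)) tau) / (r - 1).
Proof.
  intro Hr. unfold radial_quotient. unfold Im, Cdiv; simpl. field. lra.
Qed.

Lemma Re_inner_star_radial {H : HilbertSpace} (f : H -> H) (tau : H) (r : R) :
  unit_sphere tau -> 0 < r < 1 ->
  2 * Re (inner (f (scal (RtoC r) tau)) (star tau (scal (RtoC r) tau))) =
  2 / (1 + r) * Re (radial_quotient f tau r).
Proof.
  intros Ht Hr. rewrite Re_inner_star, Re_radial_quotient by lra.
  rewrite norm_radial, Rabs_pos_eq by (try exact Ht; lra).
  rewrite inner_scal_l, inner_scal_r, inner_self, Ht, Re_Cdiv.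
  unfold Re, Im; simpl. field. nra.
Qed.

(** The limit as [r] tends to [1] of the monotonicity inequality between [x] and [r tau]: the
    terms with [f (r tau)] vanish, except the one that is divided by [1 - r^2]. *)
Lemma radial_quotient_eventually_le {H : HilbertSpace} (f : H -> H) (tau x : H) (eps : R) :
  (forall y, unit_ball y ->
    Re (Cdiv (Cplus (inner (f x) y) (inner x (f y))) (Cminus 1 (inner x y))) <=
    Re (inner (f x) x) / (1 - norm x ^ 2) + Re (inner (f y) y) / (1 - norm y ^ 2)) ->
  unit_sphere tau ->
  filterlim (fun r : R => f (scal (RtoC r) tau)) (at_left 1) (locally (zero : H)) ->
  unit_ball x -> 0 < eps ->
  at_left 1 (fun r => Re (radial_quotient f tau r) <= 2 * Re (inner (f x) (star tau x)) + eps).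
Proof.
  intros Hmono Ht Hnull Hx Heps.
  set (w := Re (inner (f x) x) / (1 - norm x ^ 2)).
  set (c := inner (f x) tau). set (d := inner x tau).
  set (n := fun r => inner x (f (scal (RtoC r) tau))).
  set (psi := fun r => (1 + r) * / r * (w + -1 *
    (((r * Re c + Re (n r)) * (1 + -1 * (r * Re d)) + (r * Im c + Im (n r)) * (-1 * (r * Im d))) *
     / ((1 + -1 * (r * Re d)) * (1 + -1 * (r * Re d)) + (r * Im d) * (r * Im d))))).
  assert (Hle : forall r, 0 < r < 1 -> Re (radial_quotient f tau r) <= psi r).
  { intros r Hr. specialize (Hmono _ (unit_ball_radial tau r Ht Hr)).
    rewrite norm_radial, Rabs_pos_eq in Hmono by (try exact Ht; lra).
    fold (n r) in Hmono. rewrite !inner_scal_r, Re_Cdiv in Hmono. fold c d w in Hmono.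
    rewrite Re_radial_quotient by lra.
    set (g := inner (f (scal (RtoC r) tau)) tau) in *.
    apply Rmult_le_reg_l with (r / (1 + r)); [apply Rdiv_lt_0_compat; lra|].
    replace (r / (1 + r) * (Re g / (r - 1))) with (- (r * Re g / (1 - r ^ 2)))
      by (field; nra).
    replace (r / (1 + r) * psi r) with (w -
      (((r * Re c + Re (n r)) * (1 + -1 * (r * Re d)) + (r * Im c + Im (n r)) * (-1 * (r * Im d))) *
     / ((1 + -1 * (r * Re d)) * (1 + -1 * (r * Re d)) + (r * Im d) * (r * Im d))))
      by (unfold psi; unfold Rminus; rewrite <- !Rmult_assoc;
          replace (r / (1 + r) * (1 + r) * / r) with 1 by (field; lra); ring).
    unfold Re, Im in *; simpl in Hmono. unfold Rdiv in *.
    match goal with |- _ <= _ - ?P * / ?D =>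
      match type of Hmono with ?P' * / ?D' <= _ =>
        replace P with P' by ring; replace D with D' by ring end end.
    replace (r * fst g * / (1 - r ^ 2)) with ((r * fst g - - 0 * snd g) * / (1 - r * (r * 1)))
      by (simpl; ring).
    lra. }
  assert (Hden : (1 + -1 * (1 * Re d)) * (1 + -1 * (1 * Re d)) + (1 * Im d) * (1 * Im d) <> 0).
  { assert (Hp := one_minus_inner_sq_pos x tau Hx (Req_le _ _ Ht)).
    rewrite Cmod_one_minus_sq in Hp. fold d in Hp. lra. }
  assert (Hlim : filterlim psi (at_left 1) (locally (2 * Re (inner (f x) (star tau x))))).
  { assert (L1 : filterlim (fun r => Re (n r)) (at_left 1) (locally 0)).
    { assert (L := filterlim_Re_inner (at_left 1) _ _ _ _ (filterlim_const x) Hnull).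
      rewrite inner_zero_r in L. exact L. }
    assert (L2 : filterlim (fun r => Im (n r)) (at_left 1) (locally 0)).
    { assert (L := filterlim_Im_inner (at_left 1) _ _ _ _ (filterlim_const x) Hnull).
      rewrite inner_zero_r in L. exact L. }
    assert (Lid := filterlim_at_left_id 1).
    replace (2 * Re (inner (f x) (star tau x))) with ((1 + 1) * / 1 * (w + -1 *
    (((1 * Re c + 0) * (1 + -1 * (1 * Re d)) + (1 * Im c + 0) * (-1 * (1 * Im d))) *
     / ((1 + -1 * (1 * Re d)) * (1 + -1 * (1 * Re d)) + (1 * Im d) * (1 * Im d))))).
    - unfold psi.
      filterlim_arith.
    - rewrite Re_inner_star, Re_Cdiv. fold w c d.
      replace (Re (Cminus 1 d)) with (1 + -1 * (1 * Re d)) by (unfold Re; simpl; ring).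
      replace (Im (Cminus 1 d)) with (-1 * (1 * Im d)) by (unfold Im; simpl; ring).
      replace ((1 + -1 * (1 * Re d)) ^ 2 + (-1 * (1 * Im d)) ^ 2) with
        ((1 + -1 * (1 * Re d)) * (1 + -1 * (1 * Re d)) + (1 * Im d) * (1 * Im d)) by ring.
      field. intro E. apply Hden. rewrite <- E. ring. }
  rewrite filterlim_R_iff in Hlim by apply at_left_proper_filter.
  apply at_left_1_iff. destruct (proj1 (at_left_1_iff _) (Hlim eps Heps)) as (r0 & Hr0 & Hc).
  exists r0. split; [exact Hr0|]. intros r Hr.
  specialize (Hc r Hr). apply Rabs_def2 in Hc. specialize (Hle r ltac:(lra)). lra.
Qed.
(** * Decay along the semigroup *)

Lemma filterlim_d_tau {T : Type} {H : HilbertSpace} (F : (T -> Prop) -> Prop) {FF : Filter F}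
    (tau z : H) (W : T -> H) :
  unit_ball z -> filterlim W F (locally z) ->
  filterlim (fun t => d_tau tau (W t)) F (locally (d_tau tau z)).
Proof.
  intros Hz HW.
  assert (Lp := filterlim_Re_inner F _ _ _ _ HW (filterlim_const tau)).
  assert (Lq := filterlim_Im_inner F _ _ _ _ HW (filterlim_const tau)).
  assert (Ln := filterlim_Re_inner F _ _ _ _ HW HW).
  assert (E : forall x : H, d_tau tau x =
    ((1 + -1 * Re (inner x tau)) * (1 + -1 * Re (inner x tau)) +
     Im (inner x tau) * Im (inner x tau)) * / (1 + -1 * Re (inner x x))).
  { intro x. unfold d_tau. rewrite Cmod_one_minus_sq, norm_sq_Re. unfold Rdiv, Rminus.
    f_equal; [ring|f_equal; ring]. }
  rewrite E. apply (filterlim_ext _ _ (fun t => eq_sym (E (W t)))).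
  assert (Hn : 1 + -1 * Re (inner z z) <> 0).
  { apply norm_sq_lt_1 in Hz. rewrite norm_sq_Re in Hz. lra. }
  filterlim_arith.
Qed.

(** The slope [2 * Re <k, x^*>] is minus the logarithmic derivative of [d_tau] along the curve. *)
Lemma right_derivative_d_tau {H : HilbertSpace} (tau : H) (X : R -> H) (k : H) :
  unit_sphere tau -> curve_slope X k -> unit_ball (X 0) ->
  right_derivative (fun t => d_tau tau (X t))
    (- (2 * Re (inner k (star tau (X 0)))) * d_tau tau (X 0)).
Proof.
  intros Htau HX HB. assert (HC := curve_slope_const tau).
  destruct (right_derivative_extension _ _ (right_derivative_norm_sq X k HX)) as (A & EA & DA).
  destruct (right_derivative_extension _ _ (right_derivative_Re_inner X _ k _ HX HC))
    as (p & Ep & Dp).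
  destruct (right_derivative_extension _ _ (right_derivative_Im_inner X _ k _ HX HC))
    as (q & Eq & Dq).
  rewrite inner_zero_r in Dp, Dq.
  assert (HA : 0 < 1 - A 0).
  { rewrite EA by lra. assert (HA := norm_sq_lt_1 _ HB). lra. }
  assert (HD : 0 < (1 - p 0) ^ 2 + q 0 ^ 2).
  { rewrite Ep, Eq, <- Cmod_one_minus_sq by lra. apply one_minus_inner_sq_pos; [exact HB|].
    right. exact Htau. }
  apply is_derive_right_derivative with (psi := fun t => ((1 - p t) ^ 2 + q t ^ 2) / (1 - A t)).
  - intros t Ht. unfold d_tau. rewrite Cmod_one_minus_sq, Ep, Eq, EA by exact Ht. reflexivity.
  - auto_derive.
    + repeat split; try (eexists; eassumption). lra.
    + replace (Derive (fun x => A x) 0) with (- 2 * Re (inner k (X 0)))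
        by (symmetry; apply is_derive_unique, DA).
      replace (Derive (fun x => p x) 0) with (- Re (inner k tau) - Re 0)
        by (symmetry; apply is_derive_unique, Dp).
      replace (Derive (fun x => q x) 0) with (- Im (inner k tau) - Im 0)
        by (symmetry; apply is_derive_unique, Dq).
      unfold d_tau. rewrite Re_inner_star, Re_Cdiv, Cmod_one_minus_sq.
      replace (Re (Cminus 1 (inner (X 0) tau))) with (1 - p 0)
        by (rewrite Ep by lra; unfold Re; simpl; ring).
      replace (Im (Cminus 1 (inner (X 0) tau))) with (- q 0)
        by (rewrite Eq by lra; unfold Im; simpl; ring).
      rewrite <- EA, <- Ep, <- Eq by lra.
      unfold Re, Im in *; simpl in *. field. split; nra.
Qed.

(** A continuity induction on the largest interval on which [h s <= h 0 + eps * s]. *)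
Lemma nonpositive_right_derivative_le (h : R -> R) (T : R) : 0 <= T ->
  (forall t, 0 <= t < T -> exists l, l <= 0 /\ right_derivative (fun s => h (t + s)) l) ->
  (forall t, 0 < t <= T -> filterlim (fun s => h (t - s)) (at_right 0) (locally (h t))) ->
  h T <= h 0.
Proof.
  intros HT Hright Hleft. apply le_epsilon. intros eta Heta.
  set (e := eta / (T + 1)).
  assert (He : 0 < e) by (apply Rdiv_lt_0_compat; lra).
  assert (HeT : e * T <= eta).
  { unfold e. replace (eta / (T + 1) * T) with (eta * (T / (T + 1))) by (field; lra).
    assert (T / (T + 1) <= 1).
    { apply Rmult_le_reg_r with (T + 1); [lra|]. field_simplify; lra. }
    nra. }
  set (good := fun t => 0 <= t <= T /\ forall s, 0 <= s <= t -> h s <= h 0 + e * s).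
  destruct (completeness good) as [m [Hub Hlub]].
  { exists T. intros t [Ht _]. lra. }
  { exists 0. split; [lra|]. intros s Hs. replace s with 0 by lra. lra. }
  assert (Hm0 : 0 <= m).
  { apply Hub. split; [lra|]. intros s Hs. replace s with 0 by lra. lra. }
  assert (HmT : m <= T) by (apply Hlub; intros t [Ht _]; lra).
  assert (Hbelow : forall s, 0 <= s < m -> h s <= h 0 + e * s).
  { intros s Hs. apply NNPP. intro Hn.
    assert (m <= s); [|lra]. apply Hlub. intros t [Ht Hgood].
    apply Rnot_lt_le. intro Hst. apply Hn, Hgood. lra. }
  assert (Hm : h m <= h 0 + e * m).
  { destruct Hm0 as [Hm0|<-]; [|lra].
    apply le_epsilon. intros d Hd.
    assert (HL := Hleft m ltac:(lra)). rewrite filterlim_R_iff in HL by apply at_right_proper_filter.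
    assert (HF : at_right 0 (fun s => 0 < s < m)).
    { exists (mkposreal m Hm0). intros s Hs Hs0. split; [exact Hs0|].
      change (Rabs (s - 0) < m) in Hs. apply Rabs_def2 in Hs. lra. }
    assert (Hex := filter_and (F := at_right 0) _ _ (HL d Hd) HF).
    apply (filter_ex (F := at_right 0)) in Hex. destruct Hex as (s & Habs & Hs).
    apply Rabs_def2 in Habs. specialize (Hbelow (m - s) ltac:(lra)). nra. }
  assert (Hgood : good m).
  { split; [lra|]. intros s Hs. destruct (Req_dec s m) as [->|]; [exact Hm|apply Hbelow; lra]. }
  destruct (Req_dec m T) as [<-|HmT']; [lra|exfalso].
  destruct (Hright m ltac:(lra)) as (l & Hl & Hd).
  unfold right_derivative in Hd. rewrite filterlim_R_iff in Hd by apply at_right_proper_filter.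
  destruct (Hd e He) as [d Hd'].
  set (q := Rmin (d / 2) (T - m)).
  assert (Hdp := cond_pos d).
  assert (Hq : 0 < q) by (apply Rmin_pos; lra).
  assert (Hq1 : q <= d / 2) by apply Rmin_l. assert (Hq2 : q <= T - m) by apply Rmin_r.
  assert (good (m + q)).
  { split; [lra|]. intros s Hs. destruct (Rle_lt_dec s m) as [Hsm|Hsm]; [apply Hgood; lra|].
    specialize (Hd' (s - m)). assert (Hb : ball 0 d (s - m)).
    { change (Rabs (s - m - 0) < d). apply Rabs_def1; lra. }
    specialize (Hd' Hb ltac:(lra)). apply Rabs_def2 in Hd'.
    replace (m + (s - m)) with s in Hd' by ring. rewrite Rplus_0_r in Hd'.
    assert (Hlt : (h s - h m) / (s - m) < e) by lra.
    apply Rmult_lt_compat_r with (r := s - m) in Hlt; [|lra].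
    replace ((h s - h m) / (s - m) * (s - m)) with (h s - h m) in Hlt by (field; lra).
    lra. }
  assert (m + q <= m) by (apply Hub; assumption). lra.
Qed.

(** Left continuity holds because [F (t - s)] contracts the [rho]-distance from [x] to [F s x],
    which tends to [0]; [sigma_gap] converts it into the norm. *)
Lemma semigroup_left_continuous {H : HilbertSpace} (F : R -> H -> H) (x : H) (t : R) :
  continuous_semigroup F -> (forall t, 0 <= t -> rho_nonexpansive (F t)) ->
  unit_ball x -> 0 < t ->
  filterlim (fun s => F (t - s) x) (at_right 0) (locally (F t x)).
Proof.
  intros HF Hrho Hx Ht. destruct HF as (Hself & Hadd & Hcont).
  assert (Hz : unit_ball (F t x)) by (apply Hself; [lra|exact Hx]).
  set (z := F t x) in *.
  assert (Hz2 := norm_sq_lt_1 z Hz).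
  assert (Hsig : filterlim (fun s => sigma x (F s x)) (at_right 0) (locally (sigma x x))).
  { assert (HW := Hcont x Hx).
    assert (Lp := filterlim_Re_inner (at_right 0) _ _ _ _ (filterlim_const x) HW).
    assert (Lq := filterlim_Im_inner (at_right 0) _ _ _ _ (filterlim_const x) HW).
    assert (Ln := filterlim_Re_inner (at_right 0) _ _ _ _ HW HW).
    assert (E : forall y : H, sigma x y = (1 - norm x ^ 2) * (1 + -1 * Re (inner y y)) *
      / ((1 + -1 * Re (inner x y)) * (1 + -1 * Re (inner x y)) +
         Im (inner x y) * Im (inner x y))).
    { intro y. unfold sigma. rewrite Cmod_one_minus_sq, (norm_sq_Re y). unfold Rdiv, Rminus.
      f_equal; [ring|f_equal; ring]. }
    rewrite E. apply (filterlim_ext _ _ (fun t => eq_sym (E (F t x)))).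
    assert (Hn : (1 + -1 * Re (inner x x)) * (1 + -1 * Re (inner x x)) +
         Im (inner x x) * Im (inner x x) <> 0).
    { assert (Hp := one_minus_inner_sq_pos x x Hx (Rlt_le _ _ Hx)).
      rewrite Cmod_one_minus_sq in Hp. lra. }
    filterlim_arith. }
  assert (Hxx : sigma x x = 1).
  { unfold sigma. rewrite Cmod_one_minus_sq, inner_self. unfold Re, Im; simpl.
    apply norm_sq_lt_1 in Hx. field. simpl in Hx. nra. }
  rewrite Hxx in Hsig. rewrite filterlim_R_iff in Hsig by apply at_right_proper_filter.
  apply (filterlim_locally_ball_norm (K := C_AbsRing) (U := hilbert_carrier H) _ _). intro eps.
  assert (He := cond_pos eps).
  set (c := eps ^ 2 * (1 - norm z ^ 2) / 4).
  assert (Hc : 0 < c).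
  { unfold c. apply Rdiv_lt_0_compat; [|lra]. apply Rmult_lt_0_compat; [apply pow_lt, He|lra]. }
  assert (HF : at_right 0 (fun s => 0 < s < t)).
  { exists (mkposreal t Ht). intros s Hs Hs0. split; [exact Hs0|].
    change (Rabs (s - 0) < t) in Hs. apply Rabs_def2 in Hs. lra. }
  generalize (filter_and (F := at_right 0) _ _ (Hsig c Hc) HF). apply filter_imp.
  intros s [Hs Hst]. apply Rabs_def2 in Hs.
  assert (Hw : unit_ball (F (t - s) x)) by (apply Hself; [lra|exact Hx]).
  assert (Hsx : unit_ball (F s x)) by (apply Hself; [lra|exact Hx]).
  assert (Ez : F (t - s) (F s x) = z).
  { rewrite <- Hadd by (try lra; exact Hx). unfold z. f_equal. ring. }
  assert (Hge : sigma x (F s x) <= sigma (F (t - s) x) z).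
  { rewrite <- Ez. apply rho_le_sigma_ge; try assumption.
    - rewrite Ez. exact Hz.
    - apply Hrho; [lra|exact Hx|exact Hsx]. }
  assert (Hgap := sigma_gap _ _ Hw Hz).
  assert (Hlt : norm (minus (F (t - s) x) z) ^ 2 < eps ^ 2).
  { apply Rmult_lt_reg_l with (1 - norm z ^ 2); [lra|]. unfold c in Hs. lra. }
  change (norm (minus (F (t - s) x) z) < eps).
  apply Rsqr_incrst_0; [rewrite !Rsqr_pow2; exact Hlt|apply norm_ge_0|lra].
Qed.

(** By the semigroup law the right derivative of [exp (t * gamma) * d_tau (F t x)] at any [t] is
    governed by the slope at [F t x]; it is nonpositive. *)
Lemma decay_rate_of_slope {H : HilbertSpace} (F : R -> H -> H) (f : H -> H) (tau : H) (gamma : R) :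
  continuous_semigroup F -> (forall t, 0 <= t -> rho_nonexpansive (F t)) -> generated_by F f ->
  unit_sphere tau ->
  (forall x, unit_ball x -> gamma <= 2 * Re (inner (f x) (star tau x))) ->
  decay_rate F tau gamma.
Proof.
  intros HF Hrho Hgen Htau Hslope x T Hx HT.
  assert (Hself : forall t z, 0 <= t -> unit_ball z -> unit_ball (F t z))
    by (intros t z Ht; apply (proj1 HF t Ht)).
  set (h := fun t => exp (t * gamma) * d_tau tau (F t x)).
  assert (Hh : h T <= h 0).
  { apply nonpositive_right_derivative_le; [exact HT| |].
    - intros t Ht. assert (Hz := Hself t x (proj1 Ht) Hx). set (z := F t x) in *.
      assert (HD := right_derivative_d_tau tau _ (f z) Htau (semigroup_slope F f z HF Hgen Hz)).
      cbv beta in HD. rewrite (semigroup_at_0 F z HF Hz) in HD. specialize (HD Hz).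
      destruct (right_derivative_extension _ _ HD) as (psi & Epsi & Dpsi).
      exists (exp (t * gamma) * d_tau tau z * (gamma - 2 * Re (inner (f z) (star tau z)))).
      assert (Hd : 0 <= d_tau tau z).
      { unfold d_tau. apply Rmult_le_pos; [apply pow2_ge_0|].
        left. apply Rinv_0_lt_compat. apply norm_sq_lt_1 in Hz. lra. }
      split.
      + specialize (Hslope z Hz). assert (He := exp_pos (t * gamma)).
        assert (0 <= exp (t * gamma) * d_tau tau z) by (apply Rmult_le_pos; lra). nra.
      + apply is_derive_right_derivative with (psi := fun s => exp ((t + s) * gamma) * psi s).
        * intros s Hs. unfold h. rewrite Epsi by exact Hs.
          replace (F (t + s) x) with (F s z); [reflexivity|].
          unfold z. rewrite <- (proj1 (proj2 HF)) by (try lra; exact Hx). f_equal. ring.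
        * auto_derive.
          -- eexists; eassumption.
          -- replace (Derive (fun x => psi x) 0) with
               (- (2 * Re (inner (f z) (star tau z))) * d_tau tau z)
               by (symmetry; apply is_derive_unique, Dpsi).
             rewrite Epsi, (semigroup_at_0 F z HF Hz), Rplus_0_r by lra. ring.
    - intros t Ht. assert (Hz := Hself t x ltac:(lra) Hx).
      assert (L := filterlim_d_tau (at_right 0) tau _ _ Hz
        (semigroup_left_continuous F x t HF Hrho Hx ltac:(lra))).
      assert (Le : filterlim (fun s => exp ((t - s) * gamma)) (at_right 0)
        (locally (exp (t * gamma)))).
      { replace (exp (t * gamma)) with (exp ((t - 0) * gamma)) by (f_equal; ring).
        intros P HP. apply filter_le_within.
        assert (HC : continuous (fun s => exp ((t - s) * gamma)) 0).
        { apply continuity_pt_filterlim, derivable_continuous_pt.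
          eexists. apply is_derive_Reals. auto_derive; [exact I|reflexivity]. }
        exact (HC P HP). }
      unfold h. filterlim_arith. }
  unfold h in Hh. rewrite (semigroup_at_0 F x HF Hx), Rmult_0_l, exp_0, Rmult_1_l in Hh.
  assert (Hpos := exp_pos (- T * gamma)).
  apply Rmult_le_compat_l with (r := exp (- T * gamma)) in Hh; [|lra].
  rewrite <- Rmult_assoc, <- exp_plus in Hh.
  replace (- T * gamma + T * gamma) with 0 in Hh by ring. rewrite exp_0, Rmult_1_l in Hh.
  exact Hh.
Qed.

Lemma slope_of_decay_rate {H : HilbertSpace} (F : R -> H -> H) (f : H -> H) (tau x : H) (gamma : R) :
  continuous_semigroup F -> generated_by F f -> unit_sphere tau -> decay_rate F tau gamma ->
  unit_ball x -> gamma <= 2 * Re (inner (f x) (star tau x)).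
Proof.
  intros HF Hgen Htau Hdecay Hx. assert (H0 := semigroup_at_0 F x HF Hx).
  assert (HD := right_derivative_d_tau tau _ (f x) Htau (semigroup_slope F f x HF Hgen Hx)).
  cbv beta in HD. rewrite H0 in HD. specialize (HD Hx).
  destruct (right_derivative_extension _ _ HD) as (psi & Epsi & Dpsi).
  assert (Hd : 0 < d_tau tau x).
  { apply Rdiv_lt_0_compat; [apply one_minus_inner_sq_pos; [exact Hx|right; exact Htau]|].
    apply norm_sq_lt_1 in Hx. lra. }
  set (phi := fun t => exp (- t * gamma) * d_tau tau x - psi t).
  assert (Hphi : is_derive phi 0
    (d_tau tau x * (2 * Re (inner (f x) (star tau x)) - gamma))).
  { unfold phi. auto_derive.
    - eexists; eassumption.
    - replace (Derive (fun x => psi x) 0) with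
        (- (2 * Re (inner (f x) (star tau x))) * d_tau tau x)
        by (symmetry; apply is_derive_unique, Dpsi).
      rewrite Ropp_0, Rmult_0_l, exp_0. ring. }
  assert (Hge := right_derivative_nonneg phi _
    (is_derive_right_derivative phi phi _ (fun _ _ => eq_refl) Hphi)).
  assert (0 <= d_tau tau x * (2 * Re (inner (f x) (star tau x)) - gamma)); [|nra].
  apply Hge. intros t Ht. unfold phi. rewrite !Epsi, H0 by lra.
  rewrite Ropp_0, Rmult_0_l, exp_0. specialize (Hdecay x t Hx ltac:(lra)). lra.
Qed.
(** * The holomorphic case *)

Definition complex_derivative (g : C -> C) (z l : C) : Prop :=
  forall eps, 0 < eps -> exists delta, 0 < delta /\ forall w, Cmod (Cminus w z) < delta ->
    Cmod (Cminus (Cminus (g w) (g z)) (Cmult l (Cminus w z))) <= eps * Cmod (Cminus w z).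

Lemma Im_le_Cmod (c : C) : Rabs (Im c) <= Cmod c.
Proof. eapply Rle_trans; [apply Rmax_r|apply (Rmax_Cmod c)]. Qed.

Lemma complex_derivative_cauchy_riemann (g : C -> C) (x y : R) (l : C) :
  complex_derivative g (x, y) l ->
  cauchy_riemann (fun x y => Re (g (x, y))) (fun x y => Im (g (x, y))) x y (Re l) (Im l).
Proof.
  intro Hg.
  assert (Hbox : forall eps : posreal, exists delta : posreal, forall u v,
      Rabs (u - x) < delta -> Rabs (v - y) < delta ->
      Cmod (Cminus (Cminus (g (u, v)) (g (x, y))) (Cmult l (Cminus (u, v) (x, y)))) <=
      eps * Rmax (Rabs (u - x)) (Rabs (v - y))).
  { intro eps. assert (He := cond_pos eps).
    destruct (Hg (eps / 2) ltac:(lra)) as (d & Hd & Hw).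
    exists (mkposreal _ (is_pos_div_2 (mkposreal d Hd))). simpl. intros u v Hu Hv.
    assert (Hc : Cmod (Cminus (u, v) (x, y)) <= 2 * Rmax (Rabs (u - x)) (Rabs (v - y))).
    { eapply Rle_trans; [apply Cmod_2Rmax|]. simpl.
      assert (Hs : sqrt 2 <= 2).
      { rewrite <- (sqrt_square 2) at 2 by lra. apply sqrt_le_1_alt. lra. }
      assert (H0 := Rabs_pos (u - x)). assert (H1 := Rmax_l (Rabs (u - x)) (Rabs (v - y))).
      apply Rmult_le_compat_r; [unfold Rminus in *; lra|exact Hs]. }
    assert (Hm : Rmax (Rabs (u - x)) (Rabs (v - y)) < d / 2) by (apply Rmax_lub_lt; assumption).
    eapply Rle_trans; [apply Hw; lra|]. nra. }
  split; intro eps; destruct (Hbox eps) as [d Hd]; exists d; intros u v Hu Hv;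
    (eapply Rle_trans; [|apply (Hd u v Hu Hv)]).
  - eapply Rle_trans; [|apply re_le_Cmod]. right. f_equal. unfold Re, Im; simpl. ring.
  - eapply Rle_trans; [|apply Im_le_Cmod]. right. f_equal. unfold Re, Im; simpl. ring.
Qed.

Lemma cauchy_riemann_mult (u v u' v' : R -> R -> R) (x y a b a' b' : R) :
  cauchy_riemann u v x y a b -> cauchy_riemann u' v' x y a' b' -> exists c d,
  cauchy_riemann (fun x y => u x y * u' x y + v x y * - v' x y)
    (fun x y => u x y * v' x y + v x y * u' x y) x y c d.
Proof.
  intros [Hu Hv] [Hu' Hv'].
  assert (Hn : differentiable_pt_lim (fun x y => - v' x y) x y (- b') (- a')).
  { eapply differentiable_pt_lim_eq.
    - apply (differentiable_pt_lim_comp (fun s _ => - s) v' v' x y (- (1)) 0);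
        [|exact Hv'|exact Hv'].
      apply differentiable_pt_lim_proj1_0, derivable_pt_lim_opp, derivable_pt_lim_id.
    - ring.
    - ring. }
  exists (a * u' x y + u x y * a' - (b * v' x y + v x y * b')),
    (b * u' x y + u x y * b' + (a * v' x y + v x y * a')). split.
  - eapply differentiable_pt_lim_eq; [exact (differentiable_pt_lim_combination u v u'
      (fun x y => - v' x y) _ _ _ _ _ _ _ _ _ _ Hu Hv Hu' Hn)| |]; cbv beta; ring.
  - eapply differentiable_pt_lim_eq; [exact (differentiable_pt_lim_combination u v v' u'
      _ _ _ _ _ _ _ _ _ _ Hu Hv Hv' Hu')| |]; ring.
Qed.

Lemma complex_derivative_inv_one_minus (z : C) : z <> 1 ->
  complex_derivative (fun w => Cinv (Cminus 1 w)) z (Cinv (Cminus 1 z) * Cinv (Cminus 1 z))%C.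
Proof.
  intros Hz eps Heps.
  assert (Hz1 : Cminus 1 z <> 0) 
    by (intro E; apply Hz; replace z with (Cminus 1 (Cminus 1 z)) by ring; rewrite E; ring).
  set (m := Cmod (Cminus 1 z)). assert (Hm : 0 < m) by (apply Cmod_gt_0, Hz1).
  exists (Rmin (m / 2) (eps * m ^ 3 / 2)). assert (Hm3 : 0 < m ^ 3) by (apply pow_lt, Hm).
  assert (He : 0 < eps * m ^ 3 / 2).
  { apply Rdiv_lt_0_compat; [|lra]. apply Rmult_lt_0_compat; assumption. }
  split; [apply Rmin_pos; lra|]. intros w Hw.
  assert (Hw1 := Rlt_le_trans _ _ _ Hw (Rmin_l _ _)).
  assert (Hw2 := Rlt_le_trans _ _ _ Hw (Rmin_r _ _)).
  assert (Hmw : m / 2 <= Cmod (Cminus 1 w)).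
  { assert (Htri := Cmod_triangle (Cminus 1 w) (Cminus w z)).
    replace (Cplus (Cminus 1 w) (Cminus w z)) with (Cminus 1 z) in Htri by ring.
    fold m in Htri. lra. }
  assert (Hw0 : Cminus 1 w <> 0) by (apply Cmod_gt_0; lra).
  replace (Cminus (Cminus (Cinv (Cminus 1 w)) (Cinv (Cminus 1 z)))
      (Cmult (Cinv (Cminus 1 z) * Cinv (Cminus 1 z))%C (Cminus w z)))
    with (Cmult (Cmult (Cinv (Cminus 1 w)) (Cinv (Cminus 1 z) * Cinv (Cminus 1 z))%C)
      (Cmult (Cminus w z) (Cminus w z))) by (field; split; assumption).
  rewrite !Cmod_mult, !Cmod_inv by assumption. fold m.
  set (k := Cmod (Cminus w z)) in *. set (n := Cmod (Cminus 1 w)) in *.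
  assert (Hk : 0 <= k) by apply Cmod_ge_0.
  rewrite <- Rmult_assoc. apply Rmult_le_compat_r; [exact Hk|].
  apply Rmult_le_reg_l with (n * m ^ 2); [apply Rmult_lt_0_compat; [lra|apply pow_lt, Hm]|].
  replace (n * m ^ 2 * (/ n * (/ m * / m) * k)) with k by (field; lra).
  apply Rle_trans with (m / 2 * m ^ 2 * eps).
  - replace (m / 2 * m ^ 2 * eps) with (eps * m ^ 3 / 2) by field. lra.
  - apply Rmult_le_compat_r; [lra|]. apply Rmult_le_compat_r; [apply pow2_ge_0|exact Hmw].
Qed.

Lemma holomorphic_on_disc {H : HilbertSpace} (f : H -> H) (tau : H) (z : C) :
  holomorphic_on_ball f -> unit_sphere tau -> Cmod z < 1 ->
  exists l, complex_derivative (fun w => inner (f (scal w tau)) tau) z l.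
Proof.
  intros Hf Htau Hz.
  assert (Hx : unit_ball (scal z tau : H)).
  { unfold unit_ball. rewrite norm_scal_eq, Htau. lra. }
  destruct (Hf _ Hx) as [L [HL Hdom]].
  exists (inner (L tau) tau). intros eps Heps.
  destruct (Hdom (scal z tau) (fun P HP => HP) (mkposreal eps Heps)) as [d Hd].
  exists d. split; [apply cond_pos|]. intros w Hw.
  set (p := scal w tau : H). set (q := scal z tau : H).
  assert (Esub : minus p q = scal (Cminus w z) tau).
  { symmetry. exact (scal_minus_distr_r (K := C_AbsRing) (V := hilbert_carrier H) w z tau). }
  assert (Hnorm : norm (minus p q) = Cmod (Cminus w z)).
  { rewrite Esub, norm_scal_eq, Htau. ring. }
  assert (Hball : ball q d p).
  { apply (norm_compat1 (V := hilbert_carrier H)).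
    change (norm (minus p q) < d). rewrite Hnorm. exact Hw. }
  specialize (Hd _ Hball). simpl in Hd.
  change (norm (minus (minus (f p) (f q)) (L (minus p q))) <= eps * norm (minus p q)) in Hd.
  rewrite Hnorm in Hd. eapply Rle_trans; [|exact Hd].
  rewrite Esub. replace (L (scal (Cminus w z) tau)) with (scal (Cminus w z) (L tau) : H)
    by (symmetry; exact (linear_scal L HL (Cminus w z) tau)).
  fold p q. set (a := f p). set (b := f q). set (c := scal (Cminus w z) (L tau) : H).
  replace (Cminus (Cminus (inner a tau) (inner b tau)) (Cmult (inner (L tau) tau) (Cminus w z)))
    with (inner (minus (minus a b) c) tau).
  - eapply Rle_trans; [apply Cmod_inner_le|]. rewrite Htau. right. apply Rmult_1_r.
  - unfold c. rewrite !inner_minus_l, inner_scal_l. ring.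
Qed.

(** With [g z = <f (z tau), tau>], the slope bound says that
    [p z = - 2 g z / (1 - z)^2 - b (1 + z) / (1 - z)] has nonnegative real part on the unit disc.
    Here [Re p = o(1 / (1 - r))] along the radius, hence so is [Im p]. *)
Lemma holomorphic_radial_quotient_Im {H : HilbertSpace} (f : H -> H) (tau : H) (b : R) :
  holomorphic_on_ball f -> unit_sphere tau ->
  (forall x, unit_ball x -> b <= 2 * Re (inner (f x) (star tau x))) ->
  is_radial_limit f tau b ->
  filterlim (fun r => Im (radial_quotient f tau r)) (at_left 1) (locally 0).
Proof.
  intros Hf Htau Hslope Hlim.
  set (g := fun z : C => inner (f (scal z tau)) tau).
  set (I := fun z : C => Cinv (Cminus 1 z)).
  set (gr := fun x y => Re (g (x, y))). set (gi := fun x y => Im (g (x, y))).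
  set (ir := fun x y => Re (I (x, y))). set (ii := fun x y => Im (I (x, y))).
  (* [p = (- 2 * g * I - 2 * b) * I + b] *)
  set (wr := fun x y => -2 * (gr x y * ir x y + gi x y * - ii x y) + -2 * b).
  set (wi := fun x y => -2 * (gr x y * ii x y + gi x y * ir x y)).
  set (u := fun x y => wr x y * ir x y + wi x y * - ii x y + b).
  set (v := fun x y => wr x y * ii x y + wi x y * ir x y).
  assert (Haff : forall h x y hx hy k c, differentiable_pt_lim h x y hx hy ->
      differentiable_pt_lim (fun x y => k * h x y + c) x y (k * hx) (k * hy)).
  { intros h x y hx hy k c Hh.
    assert (Hk : derivable_pt_lim (fun s => k * s + c) (h x y) k).
    { apply is_derive_Reals. auto_derive; [exact Logic.I|ring]. }
    eapply differentiable_pt_lim_eq.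
    - apply (differentiable_pt_lim_comp (fun s _ => k * s + c) h h x y k 0);
        [apply (differentiable_pt_lim_proj1_0 (fun s => k * s + c)), Hk|exact Hh|exact Hh].
    - ring.
    - ring. }
  assert (Hext : forall h1 h2 x y hx hy, (forall x y, h1 x y = h2 x y) ->
      differentiable_pt_lim h1 x y hx hy -> differentiable_pt_lim h2 x y hx hy).
  { intros h1 h2 x y hx hy E. apply differentiable_pt_lim_ext.
    exists (mkposreal 1 Rlt_0_1). intros; apply E. }
  assert (Hmod : forall x y, x ^ 2 + y ^ 2 < 1 -> Cmod (x, y) < 1).
  { intros x y Hxy. apply Rsqr_incrst_0; [|apply Cmod_ge_0|lra].
    rewrite !Rsqr_pow2, Cmod_sq. unfold Re, Im; simpl in *. lra. }
  assert (Hcr : forall x y, x ^ 2 + y ^ 2 < 1 -> exists a c, cauchy_riemann u v x y a c).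
  { intros x y Hxy.
    destruct (holomorphic_on_disc f tau (x, y) Hf Htau (Hmod x y Hxy)) as [l Hl].
    assert (CG := complex_derivative_cauchy_riemann g x y l Hl).
    assert (CI := complex_derivative_cauchy_riemann I x y _ (complex_derivative_inv_one_minus (x, y)
      ltac:(intro E; injection E; intros; nra))).
    destruct (cauchy_riemann_mult _ _ _ _ _ _ _ _ _ _ CG CI) as (a1 & c1 & W1 & W2).
    assert (CW : cauchy_riemann wr wi x y (-2 * a1) (-2 * c1)).
    { split.
      - eapply differentiable_pt_lim_eq; [exact (Haff _ _ _ _ _ (-2) (-2 * b) W1)| |]; ring.
      - apply (Hext (fun x y => -2 * (gr x y * ii x y + gi x y * ir x y) + 0)).
        + intros s t. unfold wi. ring.
        + exact (Haff _ _ _ _ _ (-2) 0 W2). }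
    destruct (cauchy_riemann_mult _ _ _ _ _ _ _ _ _ _ CW CI) as (a2 & c2 & P1 & P2).
    exists a2, c2. split; [|exact P2].
    apply (Hext (fun x y => 1 * (wr x y * ir x y + wi x y * - ii x y) + b)).
    - intros s t. unfold u. ring.
    - eapply differentiable_pt_lim_eq; [exact (Haff _ _ _ _ _ 1 b P1)| |]; ring. }
  assert (Hir : forall x y, ir x y = (1 - x) / ((1 - x) ^ 2 + y ^ 2)).
  { intros x y. unfold ir, I, Re, Cinv; simpl. f_equal; ring. }
  assert (Hii : forall x y, ii x y = y / ((1 - x) ^ 2 + y ^ 2)).
  { intros x y. unfold ii, I, Im, Cinv; simpl. f_equal; ring. }
  assert (Hpos : forall x y, x ^ 2 + y ^ 2 < 1 -> 0 <= u x y).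
  { intros x y Hxy.
    assert (Hn : norm (scal ((x, y) : C) tau : H) ^ 2 = x ^ 2 + y ^ 2).
    { rewrite norm_scal_sq, Htau, Cmod_sq. unfold Re, Im; simpl. ring. }
    assert (Hx : unit_ball (scal ((x, y) : C) tau : H)).
    { unfold unit_ball. rewrite norm_scal_eq, Htau, Rmult_1_r. apply Hmod, Hxy. }
    specialize (Hslope _ Hx).
    rewrite Re_inner_star, inner_scal_r, inner_scal_l, inner_self, Htau, Hn, Re_Cdiv in Hslope.
    change (inner (f (scal ((x, y) : C) tau)) tau) with (g (x, y)) in Hslope.
    unfold u, wr, wi. rewrite !Hir, !Hii.
    unfold gr, gi, Re, Im in *; simpl in Hslope.
    set (s := fst (g (x, y))) in *. set (t := snd (g (x, y))) in *.
    set (m := 1 - (x ^ 2 + y ^ 2)). set (D := (1 - x) ^ 2 + y ^ 2).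
    assert (Hm : 0 < m) by (unfold m; lra).
    assert (HD : 0 < D) by (unfold D; nra).
    match goal with |- 0 <= ?L => replace L with
      (m / D * (2 * ((x * s + y * t) / m - (s * (1 - x) + t * - y) / D) - b)) end.
    - apply Rmult_le_pos; [left; apply Rdiv_lt_0_compat; assumption|].
      match type of Hslope with _ <= ?L => replace (2 * ((x * s + y * t) / m -
        (s * (1 - x) + t * - y) / D)) with L; [lra|] end.
      f_equal. f_equal; f_equal; unfold m, D; ring.
    - unfold m, D in *. field. split; nra. }
  assert (Hu : filterlim (fun r => (1 - r) * u r 0) (at_left 1) (locally 0)).
  { apply filterlim_R_iff; [apply at_left_proper_filter|]. intros eps Heps.
    assert (L : filterlim (fun r => 2 * Re (radial_quotient f tau r) + (- b) * (1 + r)) (at_left 1)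
      (locally (2 * b + (- b) * (1 + 1)))).
    { assert (Lid := filterlim_at_left_id 1). unfold is_radial_limit in Hlim. filterlim_arith. }
    replace (2 * b + - b * (1 + 1)) with 0 in L by ring.
    rewrite filterlim_R_iff in L by apply at_left_proper_filter.
    destruct (proj1 (at_left_1_iff _) (L eps Heps)) as (r0 & Hr0 & Hr).
    apply at_left_1_iff. exists r0. split; [exact Hr0|]. intros r Hr1. specialize (Hr r Hr1).
    replace ((1 - r) * u r 0) with (2 * Re (radial_quotient f tau r) + (- b) * (1 + r));
      [exact Hr|].
    rewrite Re_radial_quotient by lra. unfold u, wr, wi. rewrite !Hir, !Hii.
    change (Re (inner (f (scal (RtoC r) tau)) tau)) with (gr r 0). field. lra. }
  assert (Hv := imaginary_part_negligible u v Hcr Hpos Hu).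
  apply filterlim_R_iff; [apply at_left_proper_filter|]. intros eps Heps.
  rewrite filterlim_R_iff in Hv by apply at_left_proper_filter.
  destruct (proj1 (at_left_1_iff _) (Hv eps Heps)) as (r0 & Hr0 & Hr).
  apply at_left_1_iff. exists r0. split; [exact Hr0|]. intros r Hr1. specialize (Hr r Hr1).
  assert (E : (1 - r) * v r 0 = 2 * Im (radial_quotient f tau r)).
  { rewrite Im_radial_quotient by lra. unfold v, wr, wi. rewrite !Hir, !Hii.
    change (Im (inner (f (scal (RtoC r) tau)) tau)) with (gi r 0). field. lra. }
  rewrite E in Hr. apply Rabs_def2 in Hr. apply Rabs_def1; lra.
Qed.
(** * The equivalence *)

Lemma beta_le_slope {H : HilbertSpace} (f : H -> H) (tau x : H) :
  unit_ball x -> Rbar_le (beta f tau) (Finite (2 * Re (inner (f x) (star tau x)))).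
Proof.
  intro Hx. unfold beta. apply (proj1 (Glb_Rbar_correct _)). exists x. split; [exact Hx|reflexivity].
Qed.

Lemma le_beta {H : HilbertSpace} (f : H -> H) (tau : H) (b : Rbar) :
  (forall x, unit_ball x -> Rbar_le b (Finite (2 * Re (inner (f x) (star tau x))))) ->
  Rbar_le b (beta f tau).
Proof.
  intro Hb. unfold beta. apply (proj2 (Glb_Rbar_correct _)). intros y (x & Hx & ->). apply Hb, Hx.
Qed.

Lemma unit_ball_zero {H : HilbertSpace} : unit_ball (zero : H).
Proof.
  unfold unit_ball.
  replace (norm (zero : H)) with 0; [lra|symmetry; exact (norm_zero (V := hilbert_carrier H))].
Qed.

Lemma cond_III_beta_finite {H : HilbertSpace} (f : H -> H) (tau : H) :
  cond_III f tau -> exists b, beta f tau = Finite b.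
Proof.
  unfold cond_III. intro HIII. assert (Hle := beta_le_slope f tau _ unit_ball_zero).
  destruct (beta f tau) as [b| |]; [exists b; reflexivity|destruct Hle|destruct HIII].
Qed.

Lemma cond_III_of_lower_bound {H : HilbertSpace} (f : H -> H) (tau : H) (b : Rbar) :
  Rbar_lt m_infty b ->
  (forall x, unit_ball x -> Rbar_le b (Finite (2 * Re (inner (f x) (star tau x))))) ->
  cond_III f tau.
Proof. intros Hb Hle. exact (Rbar_lt_le_trans _ _ _ Hb (le_beta f tau b Hle)). Qed.

Lemma Rbar_glb_correct (E : Rbar -> Prop) : Rbar_is_glb E (Rbar_glb E).
Proof. unfold Rbar_glb. exact (proj2_sig (Rbar_ex_glb E)). Qed.

Lemma LimSup_le (F : (R -> Prop) -> Prop) (g : R -> R) (a : R) :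
  (forall eps, 0 < eps -> F (fun r => g r <= a + eps)) -> Rbar_le (LimSup F g) (Finite a).
Proof.
  intro Hev.
  assert (Hle : forall eps, 0 < eps -> Rbar_le (LimSup F g) (Finite (a + eps))).
  { intros eps Heps. eapply Rbar_le_trans.
    - apply (proj1 (Rbar_glb_correct _)). eexists. split; [exact (Hev eps Heps)|reflexivity].
    - apply (proj2 (Lub_Rbar_correct _)). intros y (r & Hr & ->). exact Hr. }
  destruct (LimSup F g) as [l| |]; [|exact (Hle 1 Rlt_0_1)|exact I].
  apply le_epsilon. exact Hle.
Qed.

Lemma LimSup_ge (F : (R -> Prop) -> Prop) {FF : ProperFilter F} (g : R -> R) (a : R) :
  F (fun r => a <= g r) -> Rbar_le (Finite a) (LimSup F g).
Proof.
  intro Hev. apply (proj2 (Rbar_glb_correct _)). intros s (P & HP & ->).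
  destruct (filter_ex _ (filter_and _ _ Hev HP)) as (r & Hr & HPr).
  apply Rbar_le_trans with (Finite (g r)); [exact Hr|].
  apply (proj1 (Lub_Rbar_correct _)). exists r. split; [exact HPr|reflexivity].
Qed.

(** Up to any positive error the quotient is eventually below every slope [2 * Re <f x, x^*>], and
    at [x = r tau] the slope
    is [2 / (1 + r)] times the quotient; so it tends to the infimum of the slopes. *)
Lemma radial_limit_beta {H : HilbertSpace} (f : H -> H) (tau : H) (b : R) :
  (forall x eps, unit_ball x -> 0 < eps -> at_left 1 (fun r =>
    Re (radial_quotient f tau r) <= 2 * Re (inner (f x) (star tau x)) + eps)) ->
  unit_sphere tau -> beta f tau = Finite b -> is_radial_limit f tau b.
Proof.
  intros Hup Htau Hb.
  assert (Hlow : forall x, unit_ball x -> b <= 2 * Re (inner (f x) (star tau x))).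
  { intros x Hx. assert (Hle := beta_le_slope f tau x Hx). rewrite Hb in Hle. exact Hle. }
  apply filterlim_R_iff; [apply at_left_proper_filter|]. intros eps Heps.
  assert (Hx : exists x, unit_ball x /\ 2 * Re (inner (f x) (star tau x)) < b + eps / 2).
  { apply NNPP. intro Hn. assert (Hle : Rbar_le (Finite (b + eps / 2)) (beta f tau)).
    { apply le_beta. intros x Hx. simpl. apply Rnot_lt_le. intro Hlt.
      apply Hn. exists x. split; assumption. }
    rewrite Hb in Hle. simpl in Hle. lra. }
  destruct Hx as (x & Hx & Hlt).
  destruct (proj1 (at_left_1_iff _) (Hup x (eps / 2) Hx ltac:(lra))) as (r0 & Hr0 & Hr).
  assert (L : filterlim (fun r => (1 + r) * / 2 * b) (at_left 1) (locally ((1 + 1) * / 2 * b))).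
  { assert (Lid := filterlim_at_left_id 1). filterlim_arith. }
  rewrite filterlim_R_iff in L by apply at_left_proper_filter.
  destruct (proj1 (at_left_1_iff _) (L eps Heps)) as (r1 & Hr1 & Hl).
  assert (M1 := Rmax_l r0 r1). assert (M2 := Rmax_r r0 r1).
  apply at_left_1_iff. exists (Rmax r0 r1). split; [split; [lra|apply Rmax_lub_lt; lra]|].
  intros r Hrr. specialize (Hr r ltac:(lra)). specialize (Hl r ltac:(lra)).
  assert (Hlb := Hlow _ (unit_ball_radial tau r Htau ltac:(lra))).
  rewrite (Re_inner_star_radial f tau r Htau ltac:(lra)) in Hlb.
  apply Rmult_le_compat_l with (r := (1 + r) * / 2) in Hlb; [|lra].
  replace ((1 + r) * / 2 * (2 / (1 + r) * Re (radial_quotient f tau r)))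
    with (Re (radial_quotient f tau r)) in Hlb by (field; lra).
  apply Rabs_def2 in Hl. apply Rabs_def1; lra.
Qed.

Theorem mainTheorem1 (H : HilbertSpace) (F : R -> H -> H) (f : H -> H) (tau : H)
  (hF : continuous_semigroup F)
  (hrho : forall t : R, 0 <= t -> rho_nonexpansive (F t))
  (hgen : generated_by F f)
  (hunif : forall (c : H) (r : R), unit_ball c -> uniformly_continuous_on (rho_ball c r) f)
  (htau : unit_sphere tau)
  (hnull : filterlim (fun r : R => f (scal (RtoC r) tau)) (at_left 1) (locally (zero : H))) :
  ((cond_I f tau <-> cond_II f tau) /\
   (cond_II f tau <-> cond_III f tau) /\
   (cond_III f tau <-> cond_IV F tau)) /\
  (cond_I f tau \/ cond_II f tau \/ cond_III f tau \/ cond_IV F tau ->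
     exists alpha : R,
       is_radial_limit f tau alpha /\
       beta f tau = Finite alpha /\
       decay_rate F tau alpha /\
       (forall gamma : R, decay_rate F tau gamma -> gamma <= alpha)) /\
  (holomorphic_on_ball f ->
   cond_I f tau \/ cond_II f tau \/ cond_III f tau \/ cond_IV F tau ->
     exists l : R, filterlim (radial_quotient f tau) (at_left 1) (locally (RtoC l))).
Proof.
  assert (Hup : forall x eps, unit_ball x -> 0 < eps -> at_left 1 (fun r =>
    Re (radial_quotient f tau r) <= 2 * Re (inner (f x) (star tau x)) + eps)).
  { intros x eps Hx Heps. apply radial_quotient_eventually_le; try assumption.
    intros y Hy. apply (generator_rho_monotone F); assumption. }
  assert (I_III : cond_I f tau -> cond_III f tau).
  { intro HI. apply (cond_III_of_lower_bound f tau _ HI).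
    intros x Hx. apply LimSup_le. intros eps Heps. apply Hup; assumption. }
  assert (II_I : cond_II f tau -> cond_I f tau).
  { intros [a Ha]. apply Rbar_lt_le_trans with (Finite (a - 1)); [exact Logic.I|].
    apply LimSup_ge; [apply at_left_proper_filter|].
    unfold is_radial_limit in Ha. rewrite filterlim_R_iff in Ha by apply at_left_proper_filter.
    generalize (Ha 1 Rlt_0_1). apply filter_imp. intros r Hr. apply Rabs_def2 in Hr. lra. }
  assert (IV_slope : forall gamma, decay_rate F tau gamma ->
      forall x, unit_ball x -> gamma <= 2 * Re (inner (f x) (star tau x))).
  { intros gamma Hg x Hx. apply (slope_of_decay_rate F f tau x gamma); assumption. }
  assert (IV_III : cond_IV F tau -> cond_III f tau).
  { intros [gamma Hg]. apply (cond_III_of_lower_bound f tau (Finite gamma) Logic.I).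
    exact (IV_slope gamma Hg). }
  assert (III_all : cond_III f tau -> exists b, beta f tau = Finite b /\
      (forall x, unit_ball x -> b <= 2 * Re (inner (f x) (star tau x))) /\
      is_radial_limit f tau b /\ decay_rate F tau b).
  { intro HIII. destruct (cond_III_beta_finite f tau HIII) as [b Hb]. exists b.
    assert (Hlow : forall x, unit_ball x -> b <= 2 * Re (inner (f x) (star tau x))).
    { intros x Hx. assert (Hle := beta_le_slope f tau x Hx). rewrite Hb in Hle. exact Hle. }
    repeat split; [exact Hb|exact Hlow|apply radial_limit_beta; assumption|].
    apply (decay_rate_of_slope F f); assumption. }
  assert (any_III : cond_I f tau \/ cond_II f tau \/ cond_III f tau \/ cond_IV F tau ->
      cond_III f tau) by tauto.
  assert (III_II : cond_III f tau -> cond_II f tau).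
  { intro HIII. destruct (III_all HIII) as (b & _ & _ & Hb & _). exists b. exact Hb. }
  assert (III_IV : cond_III f tau -> cond_IV F tau).
  { intro HIII. destruct (III_all HIII) as (b & _ & _ & _ & Hb). exists b. exact Hb. }
  split; [tauto|]. split.
  - intro Hany. destruct (III_all (any_III Hany)) as (b & Hb & _ & Hlim & Hdecay).
    exists b. repeat split; [exact Hlim|exact Hb|exact Hdecay|].
    intros gamma Hg. assert (Hle : Rbar_le (Finite gamma) (beta f tau))
      by exact (le_beta f tau (Finite gamma) (IV_slope gamma Hg)).
    rewrite Hb in Hle. exact Hle.
  - intros Hhol Hany. destruct (III_all (any_III Hany)) as (b & _ & Hlow & Hlim & _).
    exists b. assert (Him := holomorphic_radial_quotient_Im f tau b Hhol htau Hlow Hlim).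
    unfold is_radial_limit in Hlim.
    rewrite filterlim_R_iff in Hlim, Him by apply at_left_proper_filter.
    apply filterlim_locally. intro eps.
    generalize (filter_and (F := at_left 1) _ _ (Hlim eps (cond_pos eps)) (Him eps (cond_pos eps))).
    apply filter_imp. intros r [Hr Hi]. split; [exact Hr|exact Hi].
Qed.
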